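(* Let $u_0(t;\lambda)$ and $u_1(t;\lambda)$ be the basic solutions near $t=0$ of the hypergeometric equation $$\left\{(1-t)\mathcal{D}^2+\lambda^2t\right\}u=0,\qquad\mathcal{D}=t\frac{\mathrm{d}}{\mathrm{d}t},$$ where $u_0={}_2F_1(\lambda,-\lambda;1;t)$ and $u_1=u_0\ln(\lambda^2t)+\tilde u_1(t;\lambda)$ with $\tilde u_1$ analytic near $t=0$, $\tilde u_1(0;\lambda)=0$. Then $$u_0(1;\lambda)=\Delta_2(\lambda)=1-\zeta(2)\lambda^2+\zeta(2,2)\lambda^4-\dots=\prod_{n=1}^\infty\left(1-\frac{\lambda^2}{n^2}\right),$$ $$u_1(1;\lambda)=2\Delta_2(\lambda)\left\{\ln\lambda+\zeta(3)\lambda^2+\zeta(5)\lambda^4+\zeta(7)\lambda^6+\dots\right\}.$$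
   Context: $\zeta(2,\dots,2)$ ($k$ twos) is the multiple zeta value $\sum_{0<n_1<\dots<n_k}\frac{1}{n_1^2\cdots n_k^2}$. The solutions $u_j$ can be written $u_j=u_{j,0}-u_{j,1}\lambda^2+u_{j,2}\lambda^4-\dots$ with $u_{0,0}=1$, $u_{1,0}=\ln(\lambda^2t)$, $u_{j,k+1}(t)=\int_0^t\frac{\mathrm{d}t_1}{t_1}\int_0^{t_1}\frac{u_{j,k}(t_2)}{1-t_2}\mathrm{d}t_2$. Values at $t=1$ are limits as $t\to1^-$. The series in braces in the second formula converges for $|\lambda|<1$; $\ln\lambda^2=2\ln\lambda$. *)

(* Defs.v *)
From Stdlib Require Import Reals List Factorial.
From Coquelicot Require Import Coquelicot.

Open Scope C_scope.

Definition Cexp (z : C) : C := (exp (Re z) * cos (Im z), exp (Re z) * sin (Im z))%R.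

(* Total sum of a complex series, meaningful only for convergent series. *)
Definition CSeries (a : nat -> C) : C :=
  (Series (fun n => Re (a n)), Series (fun n => Im (a n))).

(* f 1 * ... * f N *)
Fixpoint Cprod (f : nat -> C) (N : nat) : C :=
  match N with
  | O => 1
  | S N' => Cprod f N' * f N
  end.

(* Limit of the partial products; unlike in the strict notion of a convergent
   infinite product, the value 0 is allowed, as needed when a factor vanishes. *)
Definition is_Cprod (f : nat -> C) (l : C) : Prop :=
  filterlim (Cprod f) eventually (locally l).

(* Sum over m < n_1 < ... < n_k <= N of 1 / (n_1^{s_1} ... n_k^{s_k}). *)
Fixpoint mzv_trunc (s : list nat) (m N : nat) : R :=
  match s with
  | nil => 1%R
  | a :: s' => sum_n_m (fun n => / INR n ^ a * mzv_trunc s' n N)%R (S m) N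
  end.

(* Convention n_1 < ... < n_k: the series converges iff the last entry of s
   is at least 2 (or s is empty), all entries being positive. *)
Definition mzv (s : list nat) : R :=
  real (Lim_seq (fun N => mzv_trunc s 0 N)).

Fixpoint rising (a : C) (n : nat) : C :=
  match n with
  | O => 1
  | S n' => rising a n' * (a + INR n')
  end.

Definition hyp2F1 (a b c t : C) : C :=
  CSeries (fun n => rising a n * rising b n / (rising c n * INR (fact n)) * t ^ n).

(* v = t du/dt on (0,1), for u of a real variable with complex values. *)
Definition is_eulerD (u v : R -> C) : Prop :=
  forall t : R, (0 < t < 1)%R ->
    exists d : C, @is_derive R_AbsRing C_R_NormedModule u t d /\ v t = t * d.

Definition solves_hyp_eq (lambda : C) (u : R -> C) : Prop :=
  exists v w : R -> C, is_eulerD u v /\ is_eulerD v w /\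
    forall t : R, (0 < t < 1)%R -> (1 - t) * w t + lambda ^ 2 * t * u t = 0.

Definition analytic_at_0 (f : C -> C) : Prop :=
  exists (a : nat -> C) (r : R), (0 < r)%R /\
    forall z : C, (Cmod z < r)%R -> is_series (fun n => a n * z ^ n) (f z).

Definition u0 (lambda : C) (t : R) : C := hyp2F1 lambda (- lambda) 1 t.

(* u is the second basic solution on (0,1).  The argument l is a value of
   ln lambda, so that ln (lambda^2 t) = 2 l + ln t. *)
Definition is_u1 (lambda l : C) (u : R -> C) : Prop :=
  solves_hyp_eq lambda u /\
  exists ut : C -> C,
    analytic_at_0 ut /\ ut 0 = 0 /\
    forall t : R, (0 < t < 1)%R -> u t = u0 lambda t * (2 * l + ln t) + ut t.

Definition Delta2_term (lambda : C) (k : nat) : C :=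
  (- 1) ^ k * mzv (repeat 2%nat k) * lambda ^ (2 * k).

Definition Delta2 (lambda : C) : C := CSeries (Delta2_term lambda).

(* Main.v *)
(* Put P_n = prod_(k <= n) (1 - lambda^2 / k^2), with limit P = Delta2 lambda.  The
   coefficients of u_0 are P_n - P_(n-1), so Abel's theorem gives u_0(1) = P; the expansion
   of P in multiple zeta values is the limit of the elementary symmetric expansion of P_n.

   With g(x) = sum_n P_n x^(n+1) / (n+1) one has x u_0' = - lambda^2 g and (1 - x) g' = u_0.
   Hence phi(t) = g(1 - t) solves the hypergeometric equation and vanishes at t = 1.
   The Wronskians of u_0, u_1 and phi are constant and can be read off at t = 0, where
   phi(t) = - P ln t + K + o(1) with K = sum_n (P_n - P) / (n+1); the linear relation between
   the three solutions then gives u_1(1) = 2 P ln lambda + K.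

   Finally K = S_0 for S_M = sum_n (P_(M+n) - P) (M+n)!^2 / (n! (2M+1+n)!), which tends to 0
   and satisfies, by creative telescoping, S_(M-1) - S_M = 2 P lambda^2 / (M (M^2 - lambda^2));
   expanding these fractions in geometric series yields the odd zeta values. *)
Require Import Defs.
From Stdlib Require Import Reals List Factorial Lra Lia.
From Coquelicot Require Import Coquelicot.

Open Scope C_scope.

(** * Limits and series of complex numbers *)

(** The obstacle is that u_1 is explicit only near t = 0, since [ut] is a power series of
    unspecified radius; Wronskians, constant on all of (0,1), carry that information to t = 1. The
    relation between u_0, u_1 and phi is solved for u_1 by dividing by P, hence the proof that P is
    nonzero for |lambda| < 1.

    S_M comes from zero-balanced hypergeometric series. Since P_N N!^2 = P Gamma(N+1+lambda)
    Gamma(N+1-lambda), S_M / P is the difference between lambda and 0 of the sums of Gamma(a+n)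
    Gamma(b+n) / (n! Gamma(a+b+n)) with a = M+1+lambda, b = M+1-lambda. Each sum diverges
    logarithmically, but the difference is 2 psi(M+1) - psi(M+1+lambda) - psi(M+1-lambda), with psi
    the digamma function. The recurrence psi(z+1) = psi(z) + 1/z then predicts S_(M-1) - S_M = P
    (1/(M+lambda) + 1/(M-lambda) - 2/M). The telescoping proves this with rational identities
    alone. *)

Lemma Cmod_RtoC_nonneg (x : R) : (0 <= x)%R -> Cmod x = x.
Proof. intros H. rewrite Cmod_R. now apply Rabs_pos_eq. Qed.

Lemma im_le_Cmod (c : C) : (Rabs (Im c) <= Cmod c)%R.
Proof. eapply Rle_trans; [apply Rmax_r | apply (Rmax_Cmod c)]. Qed.

Lemma filterlim_C {T : Type} (F : (T -> Prop) -> Prop) {FF : Filter F}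
  (f : T -> C) (l : C) :
  filterlim f F (locally l) <->
  forall eps : posreal, F (fun x => Cmod (f x - l) < eps)%R.
Proof.
rewrite filterlim_locally. split; intros H eps.
- assert (Hs : (0 < sqrt 2)%R) by (apply sqrt_lt_R0; lra).
  (* Balls of [C] are squares, those of the product; the square of half-side eps / sqrt 2 lies in
     the disc of radius eps. *)
  assert (He : (0 < eps / sqrt 2)%R) by (apply Rdiv_lt_0_compat; [apply eps | lra]).
  apply (filter_imp (fun x => ball l (mkposreal _ He) (f x))); [|apply H].
  intros x Hx. apply C_NormedModule_mixin_compat2 in Hx. simpl in Hx.
  replace (pos eps) with (sqrt 2 * (eps / sqrt 2))%R by (field; lra). exact Hx.
- apply (filter_imp (fun x => Cmod (f x - l) < eps)%R); [|apply H].
  intros x Hx. now apply C_NormedModule_mixin_compat1.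
Qed.

Lemma filterlim_C_Re_Im {T : Type} (F : (T -> Prop) -> Prop) {FF : Filter F}
  (f : T -> C) (l : C) :
  filterlim f F (locally l) <->
  filterlim (fun x => Re (f x)) F (locally (Re l)) /\
  filterlim (fun x => Im (f x)) F (locally (Im l)).
Proof.
rewrite !filterlim_locally. split.
- intros H; split; intros eps; apply (filter_imp (fun x => ball l eps (f x)));
    try apply H; now intros x [].
- intros [H1 H2] eps. generalize (filter_and _ _ (H1 eps) (H2 eps)).
  apply filter_imp. now intros x [].
Qed.

Section Limits.
Context {T : Type} (F : (T -> Prop) -> Prop) {FF : Filter F}.

Lemma filterlim_Cplus (f g : T -> C) (a b : C) :
  filterlim f F (locally a) -> filterlim g F (locally b) ->
  filterlim (fun x => f x + g x) F (locally (a + b)).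
Proof.
intros Hf Hg. apply (filterlim_comp_2 f g Cplus Hf Hg).
exact (@filterlim_plus C_AbsRing C_NormedModule a b).
Qed.

Lemma filterlim_Cmult (f g : T -> C) (a b : C) :
  filterlim f F (locally a) -> filterlim g F (locally b) ->
  filterlim (fun x => f x * g x) F (locally (a * b)).
Proof.
intros Hf Hg. apply (filterlim_C_Re_Im F) in Hf, Hg.
destruct Hf as [H1 H2], Hg as [H3 H4]. apply (filterlim_C_Re_Im F). simpl.
assert (M : forall (u v : T -> R) x y, filterlim u F (locally x) ->
  filterlim v F (locally y) -> filterlim (fun t => u t * v t)%R F (locally (x * y)%R)).
{ intros u v x y Hu Hv. apply (filterlim_comp_2 u v Rmult Hu Hv).
  exact (@filterlim_mult R_AbsRing x y). }
assert (A : forall (u v : T -> R) x y, filterlim u F (locally x) ->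
  filterlim v F (locally y) -> filterlim (fun t => u t + v t)%R F (locally (x + y)%R)).
{ intros u v x y Hu Hv. apply (filterlim_comp_2 u v Rplus Hu Hv).
  exact (@filterlim_plus R_AbsRing R_NormedModule x y). }
assert (O : forall (u : T -> R) x, filterlim u F (locally x) ->
  filterlim (fun t => - u t)%R F (locally (- x)%R)).
{ intros u x Hu. apply (filterlim_comp _ _ _ u Ropp F _ _ Hu).
  exact (@filterlim_opp R_AbsRing R_NormedModule x). }
split.
- apply (A _ (fun t => - (Im (f t) * Im (g t)))%R); [now apply M|].
  apply (O (fun t => Im (f t) * Im (g t))%R). now apply M.
- apply A; now apply M.
Qed.

Lemma filterlim_Copp (f : T -> C) (a : C) :
  filterlim f F (locally a) -> filterlim (fun x => - f x) F (locally (- a)).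
Proof.
intros Hf. apply (filterlim_comp _ _ _ f Copp F _ _ Hf).
exact (@filterlim_opp C_AbsRing C_NormedModule a).
Qed.

Lemma filterlim_Cminus (f g : T -> C) (a b : C) :
  filterlim f F (locally a) -> filterlim g F (locally b) ->
  filterlim (fun x => f x - g x) F (locally (a - b)).
Proof. intros Hf Hg. now apply filterlim_Cplus, filterlim_Copp. Qed.

Lemma filterlim_RtoC (f : T -> R) (a : R) :
  filterlim f F (locally a) -> filterlim (fun x => RtoC (f x)) F (locally (RtoC a)).
Proof. intros Hf. apply (filterlim_C_Re_Im F). split; [exact Hf | apply filterlim_const]. Qed.

Lemma filterlim_C_squeeze (f : T -> C) (l : C) (h : T -> R) :
  F (fun x => Cmod (f x - l) <= h x)%R -> filterlim h F (locally 0%R) ->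
  filterlim f F (locally l).
Proof.
intros Hle Hh. apply (filterlim_C F). intros eps.
rewrite filterlim_locally in Hh.
generalize (filter_and _ _ Hle (Hh eps)). apply filter_imp.
intros x [H1 H2]. eapply Rle_lt_trans; [apply H1|].
unfold ball in H2; simpl in H2; unfold AbsRing_ball in H2.
replace (h x) with (minus (h x) 0%R) by apply Rminus_0_r.
eapply Rle_lt_trans; [apply Rle_abs | apply H2].
Qed.

End Limits.

Lemma filterlim_Cmod_le {T : Type} (F : (T -> Prop) -> Prop) {FF : ProperFilter F}
  (f : T -> C) (l : C) (M : R) :
  filterlim f F (locally l) -> F (fun x => Cmod (f x) <= M)%R -> (Cmod l <= M)%R.
Proof.
intros Hf HM. apply Rnot_lt_le. intros Hlt.
assert (He : (0 < Cmod l - M)%R) by lra.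
rewrite (filterlim_C F) in Hf.
destruct (filter_ex _ (filter_and _ _ HM (Hf (mkposreal _ He)))) as [x [H1 H2]].
simpl in H2. pose proof (Cmod_triangle (f x) (l - f x)) as H3.
replace (f x + (l - f x)) with l in H3 by ring.
replace (l - f x) with (- (f x - l)) in H3 by ring.
rewrite Cmod_opp in H3. lra.
Qed.

Lemma filterlim_C_unique {T : Type} (F : (T -> Prop) -> Prop) {FF : ProperFilter F}
  (f : T -> C) (a b : C) :
  filterlim f F (locally a) -> filterlim f F (locally b) -> a = b.
Proof.
exact (fun Ha Hb => @filterlim_locally_unique _ C_AbsRing C_NormedModule F (Proper_StrongProper F FF) f a b Ha Hb).
Qed.

Lemma sum_n_C (a : nat -> C) (n : nat) :
  sum_n a n = (sum_n (fun k => Re (a k)) n, sum_n (fun k => Im (a k)) n).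
Proof.
induction n as [|n IH].
- rewrite !sum_O. apply surjective_pairing.
- rewrite !sum_Sn, IH. reflexivity.
Qed.

Lemma is_series_C (a : nat -> C) (s : C) :
  is_series a s <->
  is_series (fun n => Re (a n)) (Re s) /\ is_series (fun n => Im (a n)) (Im s).
Proof.
unfold is_series.
transitivity (filterlim (fun n => sum_n a n) eventually (locally (s : C))); [reflexivity|].
rewrite (filterlim_C_Re_Im eventually).
assert (E1 : forall n, Re (sum_n a n) = sum_n (fun k => Re (a k)) n)
  by (intros n; now rewrite sum_n_C).
assert (E2 : forall n, Im (sum_n a n) = sum_n (fun k => Im (a k)) n)
  by (intros n; now rewrite sum_n_C).
split; intros [H1 H2]; split.
- exact (filterlim_ext _ _ E1 H1).
- exact (filterlim_ext _ _ E2 H2).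
- exact (filterlim_ext _ _ (fun n => eq_sym (E1 n)) H1).
- exact (filterlim_ext _ _ (fun n => eq_sym (E2 n)) H2).
Qed.

Lemma CSeries_unique (a : nat -> C) (s : C) : is_series a s -> CSeries a = s.
Proof.
intros H. apply is_series_C in H. destruct H as [H1 H2].
unfold CSeries. apply injective_projections; now apply is_series_unique.
Qed.

Lemma is_series_CSeries (a : nat -> C) (M : nat -> R) :
  (forall n, Cmod (a n) <= M n)%R -> ex_series M -> is_series a (CSeries a).
Proof.
intros H HM. apply is_series_C. split; apply Series_correct;
  apply (@ex_series_le R_AbsRing R_CompleteNormedModule _ M); try assumption; intros n;
  (eapply Rle_trans; [|apply H]); [apply re_le_Cmod | apply im_le_Cmod].
Qed.

Lemma filterlim_Rabs_le {T : Type} (F : (T -> Prop) -> Prop) {FF : ProperFilter F}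
  (f : T -> R) (l : R) (M : R) :
  filterlim f F (locally l) -> F (fun x => Rabs (f x) <= M)%R -> (Rabs l <= M)%R.
Proof.
intros Hf HM. rewrite <- Cmod_R. apply (filterlim_Cmod_le F (fun x => RtoC (f x))).
- now apply (filterlim_RtoC F).
- revert HM. apply filter_imp. intros x. now rewrite Cmod_R.
Qed.

Lemma Series_tail_le (a M : nat -> R) (N : nat) :
  (forall n, Rabs (a n) <= M n)%R -> ex_series M ->
  (Rabs (Series a - sum_n a N) <= Series M - sum_n M N)%R.
Proof.
intros H HM.
assert (Ha' : ex_series (fun n => Rabs (a n))).
{ apply (@ex_series_le R_AbsRing R_CompleteNormedModule _ M); [|assumption]. intros n.
  change (Rabs (Rabs (a n)) <= M n)%R. now rewrite Rabs_Rabsolu. }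
assert (Ha : ex_series a) by now apply ex_series_Rabs.
rewrite (Series_incr_n a (S N)), (Series_incr_n M (S N)); try lia; try assumption.
simpl pred. rewrite !sum_n_Reals.
replace (sum_f_R0 a N + Series (fun k => a (S N + k)%nat) - sum_f_R0 a N)%R
  with (Series (fun k => a (S N + k)%nat)) by ring.
replace (sum_f_R0 M N + Series (fun k => M (S N + k)%nat) - sum_f_R0 M N)%R
  with (Series (fun k => M (S N + k)%nat)) by ring.
eapply Rle_trans.
- apply Series_Rabs. now apply (ex_series_incr_n (fun n => Rabs (a n))).
- apply Series_le; [|now apply (ex_series_incr_n M)].
  intros n. split; [apply Rabs_pos | apply H].
Qed.

Lemma filterlim_sum_n {T : Type} (F : (T -> Prop) -> Prop) {FF : Filter F}
  (a : T -> nat -> R) (b : nat -> R) (N : nat) :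
  (forall k, filterlim (fun x => a x k) F (locally (b k))) ->
  filterlim (fun x => sum_n (a x) N) F (locally (sum_n b N)).
Proof.
intros H. induction N as [|N IH].
- rewrite sum_O. eapply filterlim_ext; [|apply H]. intros x. now rewrite sum_O.
- rewrite sum_Sn.
  apply filterlim_ext with (fun x => plus (sum_n (a x) N) (a x (S N))).
  + intros x. now rewrite sum_Sn.
  + apply (filterlim_comp_2 _ _ plus IH (H (S N))).
    apply (@filterlim_plus R_AbsRing R_NormedModule).
Qed.

(** Tannery's theorem: beyond a suitable N both tails are below the tail of [M], and the first terms
    converge one by one. Its complex form serves the expansion of the Euler product, Abel limits,
    and the limits of S_M and of the truncated zeta values. *)
Lemma filterlim_Series_dominated {T : Type} (F : (T -> Prop) -> Prop)
  {FF : ProperFilter F} (a : T -> nat -> R) (b M : nat -> R) :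
  ex_series M ->
  F (fun x => forall k, Rabs (a x k) <= M k)%R ->
  (forall k, filterlim (fun x => a x k) F (locally (b k))) ->
  filterlim (fun x => Series (a x)) F (locally (Series b)).
Proof.
intros HM Ha Hab.
assert (Hb : forall k, (Rabs (b k) <= M k)%R).
{ intros k. apply (filterlim_Rabs_le F _ _ _ (Hab k)).
  revert Ha. apply filter_imp. auto. }
apply filterlim_locally. intros eps.
assert (He : (0 < eps / 3)%R) by (generalize (cond_pos eps); lra).
destruct HM as [SM HM].
pose proof (proj1 (@filterlim_locally nat R_UniformSpace eventually _ (sum_n M) SM) HM) as HN.
destruct (HN (mkposreal _ He)) as [N HN']. clear HN. specialize (HN' N (le_n N)). rename HN' into HN.
unfold ball in HN; simpl in HN; unfold AbsRing_ball, abs, minus, plus, opp in HN; simpl in HN.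
rewrite <- (is_series_unique _ _ HM) in HN.
pose proof (proj1 (@filterlim_locally T R_UniformSpace F _ _ _)
  (filterlim_sum_n F a b N Hab)) as HS.
generalize (filter_and _ _ Ha (HS (mkposreal _ He))). apply filter_imp.
intros x [Hx1 Hx2].
unfold ball in Hx2 |- *; simpl in Hx2 |- *;
  unfold AbsRing_ball, abs, minus, plus, opp in Hx2 |- *; simpl in Hx2 |- *.
assert (EM : ex_series M) by (now exists SM).
pose proof (Series_tail_le (a x) M N Hx1 EM) as H1.
pose proof (Series_tail_le b M N Hb EM) as H2.
apply Rabs_def2 in HN. apply Rabs_def2 in Hx2.
apply Rabs_le_between in H1. apply Rabs_le_between in H2.
apply Rabs_def1; lra.
Qed.

Lemma filterlim_CSeries_dominated {T : Type} (F : (T -> Prop) -> Prop)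
  {FF : ProperFilter F} (a : T -> nat -> C) (b : nat -> C) (M : nat -> R) :
  ex_series M ->
  F (fun x => forall k, Cmod (a x k) <= M k)%R ->
  (forall k, filterlim (fun x => a x k) F (locally (b k))) ->
  filterlim (fun x => CSeries (a x)) F (locally (CSeries b)).
Proof.
intros HM Ha Hab. apply (filterlim_C_Re_Im F). simpl. split;
  apply (filterlim_Series_dominated F (fun x k => _ (a x k)) _ M HM).
- revert Ha. apply filter_imp. intros x Hx k.
  eapply Rle_trans; [apply re_le_Cmod | apply Hx].
- intros k. apply (proj1 (filterlim_C_Re_Im F _ _) (Hab k)).
- revert Ha. apply filter_imp. intros x Hx k.
  eapply Rle_trans; [apply im_le_Cmod | apply Hx].
- intros k. apply (proj1 (filterlim_C_Re_Im F _ _) (Hab k)).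
Qed.

(** * Derivatives and power series *)

(* [ring] and [field] do not recognise an equation stated in the carrier of a normed
   module, which is where the lemmas on [is_series] leave it. *)
Local Ltac C_eq := match goal with |- ?x = ?y => change (@eq C x y) end.

Local Notation is_Cderive u t d := (@is_derive R_AbsRing C_R_NormedModule u t d).

Lemma is_Cderive_Re_Im (u : R -> C) (t : R) (d : C) :
  is_Cderive u t d <->
  is_derive (fun x => Re (u x)) t (Re d) /\ is_derive (fun x => Im (u x)) t (Im d).
Proof.
split.
- intros H. split.
  + exact (@filterdiff_comp' R_AbsRing R_NormedModule C_R_NormedModule R_NormedModule
      u (fun z => fst z) t _ _ H (filterdiff_linear _ is_linear_fst)).
  + exact (@filterdiff_comp' R_AbsRing R_NormedModule C_R_NormedModule R_NormedModule
      u (fun z => snd z) t _ _ H (filterdiff_linear _ is_linear_snd)).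
- intros [H1 H2]. unfold is_derive.
  (* Pairing the two coordinates is the identity up to eta for pairs, hence its own differential. *)
  assert (Hid : filterdiff (fun z : prod_NormedModule _ R_NormedModule R_NormedModule => (fst z, snd z))
    (filtermap (fun x => (Re (u x), Im (u x))) (locally t)) (fun z => (fst z, snd z))).
  { apply (filterdiff_ext (fun z => z)); [now intros []|].
    apply (filterdiff_ext_lin _ (fun z => z)); [apply filterdiff_id | now intros []]. }
  pose proof (filterdiff_comp_2 (fun x => Re (u x)) (fun x => Im (u x)) pair _ _ pair H1 H2 Hid) as H.
  apply (filterdiff_ext (fun x => (Re (u x), Im (u x)))).
  { intros x. symmetry. apply surjective_pairing. }
  exact H.
Qed.

Lemma is_Cderive_plus (u v : R -> C) (t : R) (du dv : C) :
  is_Cderive u t du -> is_Cderive v t dv ->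
  is_Cderive (fun x => u x + v x) t (du + dv).
Proof. exact (fun Hu Hv => @is_derive_plus R_AbsRing C_R_NormedModule u v t du dv Hu Hv). Qed.

Lemma is_Cderive_mult (u v : R -> C) (t : R) (du dv : C) :
  is_Cderive u t du -> is_Cderive v t dv ->
  is_Cderive (fun x => u x * v x) t (du * v t + u t * dv).
Proof.
intros Hu Hv. apply is_Cderive_Re_Im in Hu, Hv.
destruct Hu as [H1 H2], Hv as [H3 H4].
pose proof (fun f g df dg Hf Hg => @is_derive_mult R_AbsRing f g t df dg Hf Hg Rmult_comm) as M.
apply is_Cderive_Re_Im. split.
- replace (Re (du * v t + u t * dv)) with
    ((Re du * Re (v t) + Re (u t) * Re dv) - (Im du * Im (v t) + Im (u t) * Im dv))%R
    by (unfold Re, Im; simpl; ring).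
  exact (is_derive_minus _ _ _ _ _ (M _ _ _ _ H1 H3) (M _ _ _ _ H2 H4)).
- replace (Im (du * v t + u t * dv)) with
    ((Re du * Im (v t) + Re (u t) * Im dv) + (Im du * Re (v t) + Im (u t) * Re dv))%R
    by (unfold Re, Im; simpl; ring).
  exact (is_derive_plus _ _ _ _ _ (M _ _ _ _ H1 H4) (M _ _ _ _ H2 H3)).
Qed.

Lemma is_Cderive_const (c : C) (t : R) : is_Cderive (fun _ => c) t (RtoC 0).
Proof. exact (@is_derive_const R_AbsRing C_R_NormedModule c t). Qed.

Lemma is_Cderive_scal (c : C) (u : R -> C) (t : R) (du : C) :
  is_Cderive u t du -> is_Cderive (fun x => c * u x) t (c * du).
Proof.
intros Hu. replace (c * du) with (0 * u t + c * du) by ring.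
apply (is_Cderive_mult (fun _ => c)); [apply is_Cderive_const | assumption].
Qed.

Lemma is_Cderive_RtoC (u : R -> R) (t d : R) :
  is_derive u t d -> is_Cderive (fun x => RtoC (u x)) t (RtoC d).
Proof.
intros H. apply is_Cderive_Re_Im. split; [exact H|].
exact (@is_derive_const R_AbsRing R_NormedModule 0%R t).
Qed.

Lemma is_Cderive_comp (u : R -> C) (h : R -> R) (t : R) (du : C) (dh : R) :
  is_Cderive u (h t) du -> is_derive h t dh ->
  is_Cderive (fun x => u (h x)) t (dh * du).
Proof.
intros Hu Hh. rewrite <- scal_R_Cmult.
exact (@is_derive_comp R_AbsRing C_R_NormedModule u h t du dh Hu Hh).
Qed.

Lemma is_Cderive_unique (u : R -> C) (t : R) (d d' : C) :
  is_Cderive u t d -> is_Cderive u t d' -> d = d'.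
Proof.
rewrite !is_Cderive_Re_Im. intros [H1 H2] [H3 H4].
apply injective_projections.
- transitivity (Derive (fun x => Re (u x)) t); [symmetry|]; now apply is_derive_unique.
- transitivity (Derive (fun x => Im (u x)) t); [symmetry|]; now apply is_derive_unique.
Qed.

Lemma is_Cderive_continuous (u : R -> C) (t : R) (d : C) :
  is_Cderive u t d -> filterlim u (locally t) (locally (u t)).
Proof.
intros H.
exact (@ex_derive_continuous R_AbsRing C_R_NormedModule u t (ex_intro _ d H)).
Qed.

(** * Power series with complex coefficients in a real variable *)

Definition Cpower_series (a : nat -> C) (t : R) : C := CSeries (fun n => a n * RtoC t ^ n).

Lemma Cpower_series_Re_Im (a : nat -> C) (t : R) :
  Cpower_series a t = (PSeries (fun n => Re (a n)) t, PSeries (fun n => Im (a n)) t).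
Proof.
unfold Cpower_series, CSeries. apply injective_projections; simpl;
  apply Series_ext; intros n; rewrite <- RtoC_pow.
- apply re_scal_r.
- apply im_scal_r.
Qed.

Definition Cps_derive (a : nat -> C) (n : nat) : C := INR (S n) * a (S n).

Section PowerSeries.
Variables (a : nat -> C) (r M : R).
Hypothesis Hbound : forall n, (Cmod (a n) * r ^ n <= M)%R.

(** With [h] equal to [Re] or [Im], this transfers the real theory of power series to each
    component. Bounded terms at radius r give convergence only strictly inside. *)
Lemma CV_radius_gt (h : C -> R) (t : R) :
  (forall c, Rabs (h c) <= Cmod c)%R -> (Rabs t < r)%R ->
  Rbar_lt (Rabs t) (CV_radius (fun n => h (a n))).
Proof.
intros Hh Ht.
destruct (CV_radius_bounded (fun n => h (a n))) as [Hub _].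
apply (Rbar_lt_le_trans _ (Finite r)); [exact Ht|].
apply Hub. exists M. intros n.
assert (0 <= r)%R by (generalize (Rabs_pos t); lra).
rewrite Rabs_mult, (Rabs_pos_eq (r ^ n)) by now apply pow_le.
eapply Rle_trans; [|apply (Hbound n)].
apply Rmult_le_compat_r; [now apply pow_le | apply Hh].
Qed.

Lemma is_series_Cpower_series (t : R) :
  (Rabs t < r)%R -> is_series (fun n => a n * RtoC t ^ n) (Cpower_series a t).
Proof.
intros Ht. apply is_series_C. rewrite Cpower_series_Re_Im. split.
- apply (is_series_ext (fun n => scal (pow_n t n) (Re (a n)))).
  + intros n. rewrite <- RtoC_pow, re_scal_r, pow_n_pow. apply Rmult_comm.
  + apply PSeries_correct, CV_radius_inside, (CV_radius_gt Re); auto using re_le_Cmod.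
- apply (is_series_ext (fun n => scal (pow_n t n) (Im (a n)))).
  + intros n. rewrite <- RtoC_pow, im_scal_r, pow_n_pow. apply Rmult_comm.
  + apply PSeries_correct, CV_radius_inside, (CV_radius_gt Im); auto using im_le_Cmod.
Qed.

Lemma Cpower_series_derive_Re_Im (t : R) :
  Cpower_series (Cps_derive a) t =
  (PSeries (PS_derive (fun n => Re (a n))) t, PSeries (PS_derive (fun n => Im (a n))) t).
Proof.
rewrite Cpower_series_Re_Im.
apply injective_projections; apply PSeries_ext; intros n;
  [apply re_scal_l | apply im_scal_l].
Qed.

Lemma is_Cderive_Cpower_series (t : R) :
  (Rabs t < r)%R -> is_Cderive (Cpower_series a) t (Cpower_series (Cps_derive a) t).
Proof.
intros Ht. apply is_Cderive_Re_Im. rewrite Cpower_series_derive_Re_Im. split.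
- apply (is_derive_ext (PSeries (fun n => Re (a n)))).
  + intros x. now rewrite Cpower_series_Re_Im.
  + apply is_derive_PSeries, (CV_radius_gt Re); auto using re_le_Cmod.
- apply (is_derive_ext (PSeries (fun n => Im (a n)))).
  + intros x. now rewrite Cpower_series_Re_Im.
  + apply is_derive_PSeries, (CV_radius_gt Im); auto using im_le_Cmod.
Qed.

Lemma is_series_Cps_derive (t : R) :
  (Rabs t < r)%R ->
  is_series (fun n => Cps_derive a n * RtoC t ^ n) (Cpower_series (Cps_derive a) t).
Proof.
intros Ht. apply is_series_C. rewrite Cpower_series_derive_Re_Im. split.
- apply (is_series_ext (fun n => scal (pow_n t n) (PS_derive (fun n => Re (a n)) n))).
  + intros n. rewrite <- RtoC_pow, re_scal_r, pow_n_pow. unfold Cps_derive.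
    rewrite re_scal_l. apply Rmult_comm.
  + apply PSeries_correct, CV_radius_inside. rewrite CV_radius_derive.
    apply (CV_radius_gt Re); auto using re_le_Cmod.
- apply (is_series_ext (fun n => scal (pow_n t n) (PS_derive (fun n => Im (a n)) n))).
  + intros n. rewrite <- RtoC_pow, im_scal_r, pow_n_pow. unfold Cps_derive.
    rewrite im_scal_l. apply Rmult_comm.
  + apply PSeries_correct, CV_radius_inside. rewrite CV_radius_derive.
    apply (CV_radius_gt Im); auto using im_le_Cmod.
Qed.

Lemma Cpower_series_derive_continuous (t : R) :
  (Rabs t < r)%R ->
  filterlim (Cpower_series (Cps_derive a)) (locally t)
    (locally (Cpower_series (Cps_derive a) t)).
Proof.
intros Ht. apply (filterlim_C_Re_Im (locally t)). rewrite Cpower_series_derive_Re_Im. split.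
- apply (filterlim_ext (PSeries (PS_derive (fun n => Re (a n))))).
  + intros x. now rewrite Cpower_series_derive_Re_Im.
  + apply continuity_pt_filterlim, PSeries_continuity. rewrite CV_radius_derive.
    apply (CV_radius_gt Re); auto using re_le_Cmod.
- apply (filterlim_ext (PSeries (PS_derive (fun n => Im (a n))))).
  + intros x. now rewrite Cpower_series_derive_Re_Im.
  + apply continuity_pt_filterlim, PSeries_continuity. rewrite CV_radius_derive.
    apply (CV_radius_gt Im); auto using im_le_Cmod.
Qed.

End PowerSeries.

Lemma Cpower_series_0 (a : nat -> C) : Cpower_series a 0 = a 0%nat.
Proof.
rewrite Cpower_series_Re_Im, !PSeries_0. symmetry. apply surjective_pairing.
Qed.

Lemma is_series_Cmult_l (c : C) (a : nat -> C) (s : C) :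
  is_series a s -> is_series (fun n => c * a n) (c * s).
Proof. exact (@is_series_scal C_AbsRing C_NormedModule c a s). Qed.

Lemma is_series_Cplus (a b : nat -> C) (s t : C) :
  is_series a s -> is_series b t -> is_series (fun n => a n + b n) (s + t).
Proof. exact (@is_series_plus C_AbsRing C_NormedModule a b s t). Qed.

Lemma is_series_Cminus (a b : nat -> C) (s t : C) :
  is_series a s -> is_series b t -> is_series (fun n => a n - b n) (s - t).
Proof. exact (@is_series_minus C_AbsRing C_NormedModule a b s t). Qed.

Lemma is_series_Cshift (a : nat -> C) (s : C) :
  is_series (fun n => a (S n)) s -> is_series a (a 0%nat + s).
Proof.
intros H. apply (@is_series_decr_1 C_AbsRing C_NormedModule a).
assert (E : a 0%nat + s + - a 0%nat = s) by ring.
rewrite <- E in H. exact H.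
Qed.

Lemma is_Cderive_0_constant (u : R -> C) :
  (forall t, 0 < t < 1 -> is_Cderive u t (RtoC 0))%R ->
  exists c : C, forall t, (0 < t < 1)%R -> u t = c.
Proof.
intros H. exists (u (1 / 2)%R).
assert (E : forall a b, (0 < a)%R -> (b < 1)%R -> (a < b)%R -> u a = u b).
{ intros a b Ha Hb Hab. apply (@eq_is_derive C_R_NormedModule u a b); [|exact Hab].
  intros t Ht. apply H. lra. }
intros t Ht. destruct (Rtotal_order t (1 / 2)) as [h | [-> | h]].
- apply E; lra.
- reflexivity.
- symmetry. apply E; lra.
Qed.

(** * The Euler product and its expansion *)

Lemma RtoC_INR_S_neq_0 (n : nat) : RtoC (INR (S n)) <> 0.
Proof. intros H. apply RtoC_inj in H. revert H. apply not_0_INR. lia. Qed.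

Definition euler_prod (lambda : C) : nat -> C :=
  Cprod (fun n => 1 - lambda ^ 2 / (RtoC (INR n)) ^ 2).

Lemma euler_prod_S (lambda : C) (n : nat) :
  euler_prod lambda (S n) = euler_prod lambda n * (1 - lambda ^ 2 / RtoC (INR (S n)) ^ 2).
Proof. reflexivity. Qed.

Lemma mzv_trunc_twos_empty (k N : nat) : mzv_trunc (repeat 2%nat (S k)) N N = 0%R.
Proof. apply (@sum_n_m_zero R_AbelianMonoid). lia. Qed.

(** [mzv_trunc] peels off the smallest index, whereas the Euler product grows at the largest.
    Splitting on whether the largest index equals N + 1 gives the recursion of elementary symmetric
    functions; m is generalized because the induction descends through the smallest index. *)
Lemma mzv_trunc_twos_S (k m N : nat) :
  (m <= N)%nat ->
  mzv_trunc (repeat 2%nat (S k)) m (S N) =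
  (mzv_trunc (repeat 2%nat (S k)) m N + / INR (S N) ^ 2 * mzv_trunc (repeat 2%nat k) m N)%R.
Proof.
revert m. induction k as [|k IH]; intros m Hm.
- exact (@sum_n_Sm R_AbelianMonoid (fun n => / INR n ^ 2 * 1)%R (S m) N ltac:(lia)).
- change (mzv_trunc (repeat 2%nat (S (S k))) m (S N)) with
    (sum_n_m (fun n => / INR n ^ 2 * mzv_trunc (repeat 2%nat (S k)) n (S N))%R (S m) (S N)).
  rewrite sum_n_Sm by lia. rewrite mzv_trunc_twos_empty, Rmult_0_r.
  rewrite (sum_n_m_ext_loc _ (fun n => plus
    (/ INR n ^ 2 * mzv_trunc (repeat 2%nat (S k)) n N)%R
    (@mult R_Ring (/ INR (S N) ^ 2)%R (/ INR n ^ 2 * mzv_trunc (repeat 2%nat k) n N)%R))).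
  + rewrite sum_n_m_plus, (@sum_n_m_mult_l R_Ring). apply Rplus_0_r.
  + intros n Hn. rewrite IH by lia. unfold plus, mult; simpl. ring.
Qed.

Lemma sum_n_m_nonneg (u : nat -> R) (m N : nat) :
  (forall n, 0 <= u n)%R -> (0 <= sum_n_m u m N)%R.
Proof.
intros H. rewrite <- (Rmult_0_r (INR (S N - m))), <- sum_n_m_const.
now apply sum_n_m_le.
Qed.

Lemma mzv_trunc_nonneg (s : list nat) (m N : nat) : (0 <= mzv_trunc s m N)%R.
Proof.
revert m. induction s as [|a s IH]; intros m; [apply Rle_0_1|].
apply sum_n_m_nonneg. intros n. apply Rmult_le_pos; [|apply IH].
destruct n as [|n]; [|apply Rlt_le, Rinv_0_lt_compat, pow_lt, lt_0_INR; lia].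
destruct a as [|a]; simpl; [rewrite Rinv_1; lra|].
rewrite Rmult_0_l, Rinv_0. lra.
Qed.

(* A closed form of the right-hand side of
   [prod_(n <= N) (1 + r / n^2) <= exp (sum_(n <= N) 2 r / (n (n + 1)))]. *)
Definition prod_bound (r : R) (N : nat) : R := exp (2 * r * (1 - / INR (S N)))%R.

(** The right-hand side is 2 / ((N + 1) (N + 2)), and N + 2 <= 2 (N + 1). This is the source of the
    factor 2 in [prod_bound] and in the rate of convergence of P_n. *)
Lemma inv_sqr_le_telescope (N : nat) :
  (/ INR (S N) ^ 2 <= 2 * (/ INR (S N) - / INR (S (S N))))%R.
Proof.
rewrite !S_INR. pose proof (pos_INR N). set (x := INR N) in *.
apply Rminus_le_0.
replace (_ - _)%R with (x / ((x + 1) ^ 2 * (x + 1 + 1)))%R by (field; lra).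
apply Rmult_le_pos; [assumption|].
apply Rlt_le, Rinv_0_lt_compat, Rmult_lt_0_compat; [apply pow_lt|]; lra.
Qed.

Lemma prod_bound_S (r : R) (N : nat) :
  (0 <= r)%R -> ((1 + r / INR (S N) ^ 2) * prod_bound r N <= prod_bound r (S N))%R.
Proof.
intros Hr. unfold prod_bound.
replace (2 * r * (1 - / INR (S (S N))))%R
  with (2 * r * (/ INR (S N) - / INR (S (S N))) + 2 * r * (1 - / INR (S N)))%R by ring.
rewrite exp_plus. apply Rmult_le_compat_r; [apply Rlt_le, exp_pos|].
eapply Rle_trans; [apply exp_ineq1_le|].
assert (H : (r / INR (S N) ^ 2 <= 2 * r * (/ INR (S N) - / INR (S (S N))))%R).
{ pose proof (inv_sqr_le_telescope N) as H.
  apply (Rmult_le_compat_l r) in H; [|assumption]. unfold Rdiv. lra. }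
destruct H as [H | ->]; [now apply Rlt_le, exp_increasing | apply Rle_refl].
Qed.

Lemma prod_bound_le (r : R) (N : nat) : (0 <= r)%R -> (prod_bound r N <= exp (2 * r))%R.
Proof.
intros Hr. unfold prod_bound.
assert (H : (2 * r * (1 - / INR (S N)) <= 2 * r)%R).
{ assert (0 < / INR (S N))%R by (apply Rinv_0_lt_compat, lt_0_INR; lia). nra. }
destruct H as [H | ->]; [now apply Rlt_le, exp_increasing | apply Rle_refl].
Qed.

(** The left-hand side is a single term in the expansion of the product of the 1 + r / n^2, all of
    whose terms are nonnegative. The free parameter r yields geometric decay in k. *)
Lemma mzv_trunc_twos_bound (r : R) (k N : nat) :
  (0 <= r)%R -> (r ^ k * mzv_trunc (repeat 2%nat k) 0 N <= exp (2 * r))%R.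
Proof.
intros Hr. eapply Rle_trans; [|apply (prod_bound_le r N Hr)].
assert (Hpos : forall n, (0 <= r / INR (S n) ^ 2)%R).
{ intros n. apply Rmult_le_pos; [assumption|].
  apply Rlt_le, Rinv_0_lt_compat, pow_lt, lt_0_INR; lia. }
revert k. induction N as [|N IH]; intros k.
- unfold prod_bound. simpl INR. rewrite Rinv_1, Rminus_diag, Rmult_0_r, exp_0.
  destruct k; [simpl; lra|]. rewrite mzv_trunc_twos_empty, Rmult_0_r. lra.
- eapply Rle_trans; [|apply (prod_bound_S r N Hr)].
  assert (0 <= prod_bound r N)%R by apply Rlt_le, exp_pos.
  specialize (Hpos N). destruct k as [|k].
  + specialize (IH 0%nat). simpl mzv_trunc in *. nra.
  + rewrite mzv_trunc_twos_S by lia.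
    pose proof (IH (S k)) as H1. pose proof (IH k) as H2.
    apply (Rmult_le_compat_l _ _ _ Hpos) in H2. simpl pow in *. unfold Rdiv in *. nra.
Qed.

(** Monotone and bounded in N, so the limit is finite and the projection [real] in [mzv] returns
    it. *)
Lemma mzv_twos_correct (k : nat) :
  is_lim_seq (fun N => mzv_trunc (repeat 2%nat k) 0 N) (mzv (repeat 2%nat k)).
Proof.
apply Lim_seq_correct'. apply (ex_finite_lim_seq_incr _ (exp (2 * 1))).
- intros N. destruct k as [|k]; [simpl; lra|]. rewrite mzv_trunc_twos_S by lia.
  assert (0 <= / INR (S N) ^ 2)%R
    by (apply Rlt_le, Rinv_0_lt_compat, pow_lt, lt_0_INR; lia).
  pose proof (mzv_trunc_nonneg (repeat 2%nat k) 0 N). nra.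
- intros N. pose proof (mzv_trunc_twos_bound 1 k N Rle_0_1) as H.
  rewrite pow1, Rmult_1_l in H. exact H.
Qed.

Definition euler_term (lambda : C) (N k : nat) : C :=
  (- 1) ^ k * mzv_trunc (repeat 2%nat k) 0 N * lambda ^ (2 * k).

(** The terms with k > N vanish; the finite expansion is still phrased as an infinite series so that
    N can tend to infinity under a fixed summation range. *)
Lemma is_series_euler_term (lambda : C) (N : nat) :
  is_series (euler_term lambda N) (euler_prod lambda N).
Proof.
assert (E0 : forall n, euler_term lambda n 0 = 1) by (intros n; unfold euler_term; simpl; ring).
induction N as [|N IH].
- replace (euler_prod lambda 0) with (euler_term lambda 0 0 + 0) by (rewrite E0; unfold euler_prod; simpl; ring).
  apply is_series_Cshift.
  apply (is_series_ext (fun _ => RtoC 0)).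
  + intros n. symmetry. unfold euler_term. rewrite mzv_trunc_twos_empty. C_eq. ring.
  + apply is_series_C. split;
      apply (filterlim_ext (fun _ => 0%R)); try apply filterlim_const;
      intros n; symmetry; exact (@sum_n_m_const_zero R_AbelianMonoid 0 n).
- replace (euler_prod lambda (S N)) with
    (euler_term lambda (S N) 0 +
     ((euler_prod lambda N - 1) + - (lambda ^ 2 / RtoC (INR (S N)) ^ 2) * euler_prod lambda N))
    by (rewrite E0, euler_prod_S; ring).
  apply is_series_Cshift.
  apply (is_series_ext (fun k => euler_term lambda N (S k) +
    - (lambda ^ 2 / RtoC (INR (S N)) ^ 2) * euler_term lambda N k)).
  + intros k. symmetry. unfold euler_term. rewrite mzv_trunc_twos_S by lia.
    rewrite RtoC_plus, RtoC_mult, RtoC_inv, RtoC_pow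
      by (apply pow_nonzero, not_0_INR; lia).
    replace (2 * S k)%nat with (2 + 2 * k)%nat by lia. rewrite Cpow_add_r.
    rewrite Cpow_S. C_eq. field. apply RtoC_INR_S_neq_0.
  + apply is_series_Cplus.
    * apply (@is_series_incr_1 C_AbsRing C_NormedModule).
      assert (E : euler_prod lambda N - 1 + euler_term lambda N 0 = euler_prod lambda N)
        by (rewrite E0; ring).
      rewrite <- E in IH. exact IH.
    * now apply is_series_Cmult_l.
Qed.

Lemma euler_term_bound (lambda : C) :
  exists B : R, forall N k, (Cmod (euler_term lambda N k) <= B * (1 / 2) ^ k)%R.
Proof.
set (q := (Cmod lambda ^ 2)%R).
assert (Hq : (0 <= q)%R) by apply pow2_ge_0.
(* [mzv_trunc_twos_bound] is used at r = 2 q + 1: since r >= 2 q, replacing r^k by q^k gains the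
   factor (1/2)^k. *)
exists (exp (2 * (2 * q + 1))). intros N k. unfold euler_term.
rewrite !Cmod_mult, !Cmod_pow, (Cmod_R (-1)), Rabs_m1, pow1, Rmult_1_l.
rewrite Cmod_RtoC_nonneg by apply mzv_trunc_nonneg.
rewrite pow_mult. fold q.
pose proof (mzv_trunc_twos_bound (2 * q + 1) k N ltac:(lra)) as H.
pose proof (mzv_trunc_nonneg (repeat 2%nat k) 0 N) as H0.
assert (Hk : (q ^ k <= (2 * q + 1) ^ k * (1 / 2) ^ k)%R).
{ rewrite <- Rpow_mult_distr. apply pow_incr. lra. }
assert (0 <= (1 / 2) ^ k)%R by (apply pow_le; lra).
eapply Rle_trans; [apply (Rmult_le_compat_l _ _ _ H0 Hk)|].
apply (Rmult_le_compat_r ((1 / 2) ^ k)) in H; [|assumption]. lra.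
Qed.

Lemma euler_term_lim (lambda : C) (k : nat) :
  filterlim (fun N => euler_term lambda N k) eventually (locally (Delta2_term lambda k)).
Proof.
unfold euler_term, Delta2_term.
apply (filterlim_Cmult eventually); [|apply filterlim_const].
apply (filterlim_Cmult eventually); [apply filterlim_const|].
apply (filterlim_RtoC eventually), mzv_twos_correct.
Qed.

Lemma ex_series_scal_half_pow (B : R) : ex_series (fun k => B * (1 / 2) ^ k)%R.
Proof.
apply (@ex_series_scal R_AbsRing R_NormedModule B), ex_series_geom.
rewrite Rabs_pos_eq; lra.
Qed.

Lemma is_series_Delta2 (lambda : C) : is_series (Delta2_term lambda) (Delta2 lambda).
Proof.
destruct (euler_term_bound lambda) as [B HB].
apply (is_series_CSeries _ _) with (2 := ex_series_scal_half_pow B). intros k.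
apply (filterlim_Cmod_le eventually _ _ _ (euler_term_lim lambda k)).
apply filter_forall. intros N. apply HB.
Qed.

Lemma euler_prod_lim (lambda : C) :
  is_Cprod (fun n => 1 - lambda ^ 2 / (RtoC (INR n)) ^ 2) (Delta2 lambda).
Proof.
destruct (euler_term_bound lambda) as [B HB].
apply (filterlim_ext (fun N => CSeries (euler_term lambda N))).
{ intros N. apply CSeries_unique, is_series_euler_term. }
apply (filterlim_CSeries_dominated eventually _ _ _ (ex_series_scal_half_pow B)).
- apply filter_forall. intros N. apply HB.
- apply euler_term_lim.
Qed.

(** * Boundedness, rate of convergence and non-vanishing of the Euler product *)

Lemma euler_prod_bound (lambda : C) :
  exists B : R, (0 < B)%R /\ forall n, (Cmod (euler_prod lambda n) <= B)%R.
Proof.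
set (r := (Cmod lambda ^ 2)%R).
assert (Hr : (0 <= r)%R) by apply pow2_ge_0.
exists (exp (2 * r)). split; [apply exp_pos|]. intros n.
eapply Rle_trans; [|apply (prod_bound_le r n Hr)].
induction n as [|n IH].
- unfold prod_bound. simpl INR. rewrite Rinv_1, Rminus_diag, Rmult_0_r, exp_0.
  unfold euler_prod. simpl. rewrite Cmod_1. lra.
- rewrite euler_prod_S, Cmod_mult.
  eapply Rle_trans; [|apply (prod_bound_S r n Hr)].
  rewrite Rmult_comm. apply Rmult_le_compat; try apply Cmod_ge_0; try assumption.
  eapply Rle_trans; [apply Cmod_triangle|]. rewrite Cmod_opp, Cmod_1.
  rewrite Cmod_div by (apply Cpow_nz, RtoC_INR_S_neq_0).
  rewrite !Cmod_pow, Cmod_RtoC_nonneg by apply pos_INR. apply Rle_refl.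
Qed.

(** P_n - P_(n+1) = P_n lambda^2 / (n+1)^2 is summed by telescoping. The rate 1 / n is what makes
    the sum of (P_n - P) / (n + 1) converge absolutely. *)
Lemma euler_prod_rate (lambda : C) :
  exists B : R, (0 < B)%R /\
    forall n, (Cmod (euler_prod lambda n - Delta2 lambda) <= B / INR (S n))%R.
Proof.
destruct (euler_prod_bound lambda) as [A [HA HAn]].
set (r := (Cmod lambda ^ 2)%R).
assert (Hr : (0 <= r)%R) by apply pow2_ge_0.
assert (Hstep : forall n m, (Cmod (euler_prod lambda n - euler_prod lambda (m + n)) <=
   2 * r * A * (/ INR (S n) - / INR (S (m + n))))%R).
{ intros n m. induction m as [|m IH].
  - simpl Nat.add. replace (euler_prod lambda n - euler_prod lambda n) with (RtoC 0) by ring.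
    rewrite Cmod_0, Rminus_diag, Rmult_0_r. lra.
  - simpl Nat.add.
    replace (euler_prod lambda n - euler_prod lambda (S (m + n))) with
      ((euler_prod lambda n - euler_prod lambda (m + n)) +
       euler_prod lambda (m + n) * (lambda ^ 2 / RtoC (INR (S (m + n))) ^ 2))
      by (rewrite euler_prod_S; ring).
    eapply Rle_trans; [apply Cmod_triangle|]. rewrite Cmod_mult.
    rewrite Cmod_div by (apply Cpow_nz, RtoC_INR_S_neq_0).
    rewrite !Cmod_pow, (Cmod_RtoC_nonneg (INR _)) by apply pos_INR. fold r.
    assert (H : (Cmod (euler_prod lambda (m + n)) * (r / INR (S (m + n)) ^ 2) <=
      A * (r * (2 * (/ INR (S (m + n)) - / INR (S (S (m + n)))))))%R).
    { apply Rmult_le_compat; [apply Cmod_ge_0 | | apply HAn |].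
      - apply Rmult_le_pos; [assumption|].
        apply Rlt_le, Rinv_0_lt_compat, pow_lt, lt_0_INR; lia.
      - apply Rmult_le_compat_l; [assumption | apply inv_sqr_le_telescope]. }
    lra. }
(* The summand 1 keeps the constant positive when lambda = 0. *)
exists (2 * r * A + 1)%R. split; [nra|]. intros n.
apply (filterlim_Cmod_le eventually (fun N => euler_prod lambda n - euler_prod lambda N)).
- apply (filterlim_Cminus eventually); [apply filterlim_const | apply euler_prod_lim].
- exists n. intros N HN. replace N with (N - n + n)%nat by lia.
  eapply Rle_trans; [apply Hstep|].
  assert (0 < / INR (S n))%R by (apply Rinv_0_lt_compat, lt_0_INR; lia).
  assert (0 < / INR (S (N - n + n)))%R by (apply Rinv_0_lt_compat, lt_0_INR; lia).
  assert (0 <= r * A)%R by nra. unfold Rdiv. nra.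
Qed.

Lemma Delta2_neq_0 (lambda : C) : (Cmod lambda < 1)%R -> Delta2 lambda <> 0.
Proof.
intros Hl Hz. set (r := (Cmod lambda ^ 2)%R).
assert (Hr : (0 <= r < 1)%R).
{ split; [apply pow2_ge_0|]. unfold r. pose proof (Cmod_ge_0 lambda). nra. }
(* The factor k = 1 has modulus at least 1 - r; the factors k = 2, ..., n + 1 have modulus at least
   1 - 1 / k^2, and the product of these is (1 + 1 / (n+1)) / 2. *)
assert (Hlow : forall n, ((1 - r) / 2 * (1 + / INR (S n)) <= Cmod (euler_prod lambda (S n)))%R).
{ assert (Hfac : forall n, (1 - r / INR (S n) ^ 2 <=
    Cmod (1 - lambda ^ 2 / RtoC (INR (S n)) ^ 2))%R).
  { intros n. pose proof (Cmod_triangle (1 - lambda ^ 2 / RtoC (INR (S n)) ^ 2)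
      (lambda ^ 2 / RtoC (INR (S n)) ^ 2)) as H.
    replace (1 - lambda ^ 2 / RtoC (INR (S n)) ^ 2 + lambda ^ 2 / RtoC (INR (S n)) ^ 2)
      with (RtoC 1) in H by ring.
    rewrite Cmod_1 in H. rewrite (Cmod_div (lambda ^ 2)) in H
      by (apply Cpow_nz, RtoC_INR_S_neq_0).
    rewrite !Cmod_pow, (Cmod_RtoC_nonneg (INR _)) in H by apply pos_INR. fold r in H. lra. }
  induction n as [|n IH].
  - specialize (Hfac 0%nat). rewrite euler_prod_S, Cmod_mult. change (euler_prod lambda 0) with (RtoC 1).
    rewrite Cmod_1, Rmult_1_l. eapply Rle_trans; [|apply Hfac]. simpl. lra.
  - rewrite euler_prod_S, Cmod_mult. specialize (Hfac (S n)).
    assert (Hx : (1 + / INR (S (S n)) = (1 + / INR (S n)) * (1 - 1 / INR (S (S n)) ^ 2))%R).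
    { rewrite !S_INR. pose proof (pos_INR n). field. lra. }
    assert (H1 : (1 - 1 / INR (S (S n)) ^ 2 <= Cmod (1 - lambda ^ 2 / RtoC (INR (S (S n))) ^ 2))%R).
    { eapply Rle_trans; [|apply Hfac].
      assert (0 < / INR (S (S n)) ^ 2)%R by (apply Rinv_0_lt_compat, pow_lt, lt_0_INR; lia).
      unfold Rdiv. nra. }
    rewrite Hx, <- Rmult_assoc. apply Rmult_le_compat; try assumption.
    + assert (0 < / INR (S n))%R by (apply Rinv_0_lt_compat, lt_0_INR; lia). nra.
    + assert (INR (S (S n)) = INR n + 2)%R as -> by (rewrite !S_INR; ring).
      pose proof (pos_INR n). set (x := INR n) in *.
      replace (1 - 1 / (x + 2) ^ 2)%R with ((x + 1) * (x + 3) / (x + 2) ^ 2)%R by (field; lra).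
      apply Rmult_le_pos; [nra|]. apply Rlt_le, Rinv_0_lt_compat, pow_lt. lra. }
pose proof (euler_prod_lim lambda) as Hlim. rewrite Hz in Hlim.
assert (He : (0 < (1 - r) / 2)%R) by lra.
destruct (proj1 (filterlim_C eventually _ _) Hlim (mkposreal _ He)) as [N HN].
specialize (HN (S N) ltac:(lia)). specialize (Hlow N). simpl pos in HN.
replace (Cprod _ (S N) - 0) with (euler_prod lambda (S N)) in HN
  by (unfold euler_prod; ring).
assert (0 < / INR (S N))%R by (apply Rinv_0_lt_compat, lt_0_INR; lia). nra.
Qed.

(** * The first solution and its dual *)

Lemma ex_series_inv_sqr : ex_series (fun n => / INR (S n) ^ 2)%R.
Proof.
assert (Hpos : forall n, (0 <= / INR (S n) ^ 2)%R)
  by (intros n; apply Rlt_le, Rinv_0_lt_compat, pow_lt, lt_0_INR; lia).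
destruct (ex_finite_lim_seq_incr (sum_n (fun n => / INR (S n) ^ 2)%R) 2) as [l Hl];
  [| |exists l; exact Hl].
- intros n. rewrite sum_Sn. specialize (Hpos (S n)).
  change (sum_n (fun n => / INR (S n) ^ 2) n <= sum_n (fun n => / INR (S n) ^ 2) n + / INR (S (S n)) ^ 2)%R.
  lra.
- assert (H : forall n, (sum_n (fun n => / INR (S n) ^ 2) n <= 2 * (1 - / INR (S (S n))))%R).
  { induction n as [|n IH].
    - rewrite sum_O. simpl. lra.
    - rewrite sum_Sn.
      change (sum_n (fun n => / INR (S n) ^ 2) n + / INR (S (S n)) ^ 2 <=
              2 * (1 - / INR (S (S (S n)))))%R.
      pose proof (inv_sqr_le_telescope (S n)). lra. }
  intros n. specialize (H n).
  assert (0 < / INR (S (S n)))%R by (apply Rinv_0_lt_compat, lt_0_INR; lia). lra.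
Qed.

(** * One-sided limits and the logarithm *)

Lemma at_left_1_interval : at_left 1 (fun t => 0 < t < 1)%R.
Proof.
exists (mkposreal 1 Rlt_0_1). intros t Ht Hlt.
apply Rabs_def2 in Ht. unfold minus, plus, opp in Ht; simpl in Ht. lra.
Qed.

Lemma at_right_0_interval (r : R) : (0 < r)%R -> at_right 0 (fun t => 0 < t < r)%R.
Proof.
intros Hr. exists (mkposreal r Hr). intros t Ht Hlt.
apply Rabs_def2 in Ht. unfold minus, plus, opp in Ht; simpl in Ht. lra.
Qed.

Lemma filterlim_one_minus_at_right : filterlim (fun t => 1 - t)%R (at_right 0) (at_left 1).
Proof.
intros Q [d Hd]. exists d. intros t Ht Hlt. apply Hd; [|lra].
apply Rabs_def2 in Ht. unfold minus, plus, opp in Ht; simpl in Ht.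
apply Rabs_def1; unfold minus, plus, opp; simpl; lra.
Qed.

Lemma filterlim_one_minus_at_left : filterlim (fun t => 1 - t)%R (at_left 1) (locally 0%R).
Proof.
intros Q [d Hd]. exists d. intros t Ht Hlt. apply Hd.
apply Rabs_def2 in Ht. unfold minus, plus, opp in Ht; simpl in Ht.
apply Rabs_def1; unfold minus, plus, opp; simpl; lra.
Qed.

Lemma filterlim_locally_at_right (u : R -> C) (l : C) :
  filterlim u (locally 0%R) (locally l) -> filterlim u (at_right 0) (locally l).
Proof. intros H. exact (filterlim_filter_le_1 _ (@filter_le_within R (locally 0%R) _ (fun t => 0 < t)%R) H). Qed.

(** Applying ln y <= y at y = 1 / sqrt t bounds |t ln t| by 2 sqrt t on (0,1). The passage through
    [C] reuses the squeeze lemma. *)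
Lemma filterlim_mult_ln : filterlim (fun t => t * ln t)%R (at_right 0) (locally 0%R).
Proof.
assert (H : filterlim (fun t => RtoC (t * ln t)) (at_right 0) (locally (RtoC 0))).
{ apply (filterlim_C_squeeze (at_right 0) _ _ (fun t => 2 * sqrt t)%R).
  - generalize (at_right_0_interval 1 Rlt_0_1). apply filter_imp. intros t Ht.
    replace (RtoC (t * ln t) - 0) with (RtoC (t * ln t)) by ring. rewrite Cmod_R.
    assert (Hs : (0 < sqrt t)%R) by (apply sqrt_lt_R0; lra).
    assert (Ht2 : (t = sqrt t * sqrt t)%R) by (rewrite sqrt_sqrt; lra).
    assert (Hl : (ln t = - (2 * ln (/ sqrt t)))%R).
    { rewrite ln_Rinv by assumption. rewrite Ht2 at 1. rewrite ln_mult by assumption. lra. }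
    assert (Hln : (ln t < 0)%R) by (rewrite <- ln_1; apply ln_increasing; lra).
    assert (Hi : (0 < / sqrt t)%R) by now apply Rinv_0_lt_compat.
    assert (Hb : (ln (/ sqrt t) <= / sqrt t)%R).
    { pose proof (exp_ineq1_le (ln (/ sqrt t))) as H. rewrite exp_ln in H by assumption. lra. }
    rewrite Rabs_mult, (Rabs_pos_eq t), (Rabs_left (ln t)) by lra.
    rewrite Hl. rewrite Ht2 at 1.
    assert (He : (2 * sqrt t = sqrt t * sqrt t * (2 * / sqrt t))%R) by (field; lra).
    rewrite He. apply Rmult_le_compat_l; [nra | lra].
  - apply (filterlim_filter_le_1 _ (@filter_le_within R (locally 0%R) _ (fun t => 0 < t)%R)).
    assert (Hc : filterlim (fun t => 2 * sqrt t)%R (locally 0%R) (locally (2 * sqrt 0)%R)).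
    { apply (continuous_mult (fun _ => 2%R) sqrt 0%R); [apply continuous_const|].
      apply continuity_pt_filterlim, continuity_pt_sqrt. lra. }
    rewrite sqrt_0, Rmult_0_r in Hc. exact Hc. }
apply (filterlim_C_Re_Im (at_right 0)) in H. exact (proj1 H).
Qed.

(** The constant coefficient [/ INR 0] is 0 by the convention on inverses, so the series starts at n
    = 1. Both sides vanish at 0 and have derivative 1 / (1 - s). *)
Lemma PSeries_ln (s : R) :
  (0 < s < 1)%R -> PSeries (fun n => / INR n)%R s = (- ln (1 - s))%R.
Proof.
intros Hs.
assert (Hcv : forall t, (0 <= t < 1)%R -> Rbar_lt (Rabs t) (CV_radius (fun n => / INR n)%R)).
{ intros t Ht.
  apply (CV_radius_gt (fun n => RtoC (/ INR n)) 1 1) with (h := Re).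
  - intros [|n]; rewrite pow1, Rmult_1_r, Cmod_R.
    + simpl. rewrite Rinv_0, Rabs_R0. lra.
    + assert (1 <= INR (S n))%R by (rewrite S_INR; pose proof (pos_INR n); lra).
      rewrite Rabs_pos_eq by (apply Rlt_le, Rinv_0_lt_compat; lra).
      rewrite <- Rinv_1. apply Rinv_le_contravar; lra.
  - apply re_le_Cmod.
  - rewrite Rabs_pos_eq; lra. }
assert (E : (PSeries (fun n => / INR n) 0 + ln (1 - 0) = PSeries (fun n => / INR n) s + ln (1 - s))%R).
{ apply (@eq_is_derive R_NormedModule (fun x => PSeries (fun n => / INR n)%R x + ln (1 - x))%R); [|lra].
  intros t Ht.
  replace (@zero R_NormedModule)
    with (PSeries (PS_derive (fun n => / INR n)%R) t + (-1) * / (1 - t))%R.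
  - apply (@is_derive_plus R_AbsRing R_NormedModule).
    + apply is_derive_PSeries, Hcv. lra.
    + apply (is_derive_comp ln (fun x => 1 - x)%R).
      * apply is_derive_ln. lra.
      * auto_derive; [exact I | ring].
  - rewrite (PSeries_ext _ (fun _ => 1%R)).
    + unfold PSeries. rewrite (Series_ext _ (fun n => t ^ n)%R) by (intros n; ring).
      rewrite Series_geom by (rewrite Rabs_pos_eq; lra). change (/ (1 - t) + -1 * / (1 - t) = 0)%R. ring.
    + intros n. unfold PS_derive. apply Rinv_r, not_0_INR. lia. }
rewrite PSeries_0 in E. simpl INR in E. rewrite Rinv_0, Rminus_0_r, ln_1 in E. lra.
Qed.

Lemma Cpower_series_shift (a : nat -> C) (r M t : R) :
  (forall n, Cmod (a n) * r ^ n <= M)%R -> (Rabs t < r)%R ->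
  Cpower_series a t = a 0%nat + t * Cpower_series (fun n => a (S n)) t.
Proof.
intros Hb Ht. assert (0 < r)%R by (generalize (Rabs_pos t); lra).
assert (Hb' : forall n, (Cmod (a (S n)) * r ^ n <= M / r)%R).
{ intros n. apply (Rmult_le_reg_r r); [assumption|].
  replace (M / r * r)%R with M by (field; lra).
  specialize (Hb (S n)). simpl in Hb. lra. }
pose proof (is_series_Cpower_series _ _ _ Hb' t Ht) as H1.
apply (is_series_Cmult_l (RtoC t)) in H1.
unfold Cpower_series at 1. apply CSeries_unique.
replace (a 0%nat) with (a 0%nat * RtoC t ^ 0) by (simpl; ring).
apply (is_series_Cshift (fun n => a n * RtoC t ^ n)).
eapply is_series_ext; [|exact H1]. intros n. C_eq. rewrite Cpow_S. ring.
Qed.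

Lemma filterlim_Cpower_series_0 (a : nat -> C) (r M : R) :
  (0 < r)%R -> (forall n, Cmod (a n) * r ^ n <= M)%R ->
  filterlim (Cpower_series a) (at_right 0) (locally (a 0%nat)).
Proof.
intros Hr Hb. rewrite <- Cpower_series_0. apply filterlim_locally_at_right.
eapply is_Cderive_continuous, (is_Cderive_Cpower_series a r M Hb).
rewrite Rabs_R0. exact Hr.
Qed.

(** Removing the constant term leaves a factor t, and t ln t tends to 0. This controls products with
    the logarithms of u_1 and phi near 0. *)
Lemma filterlim_Cpower_series_ln (a : nat -> C) (r M : R) :
  (0 < r)%R -> (forall n, Cmod (a n) * r ^ n <= M)%R ->
  filterlim (fun t => (Cpower_series a t - a 0%nat) * ln t) (at_right 0) (locally (RtoC 0)).
Proof.
intros Hr Hb.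
assert (Hb' : forall n, (Cmod (a (S n)) * r ^ n <= M / r)%R).
{ intros n. apply (Rmult_le_reg_r r); [assumption|].
  replace (M / r * r)%R with M by (field; lra).
  specialize (Hb (S n)). simpl in Hb. lra. }
replace (RtoC 0) with (RtoC 0 * a 1%nat) by ring.
apply (filterlim_ext_loc (fun t => RtoC (t * ln t) * Cpower_series (fun n => a (S n)) t)).
- generalize (at_right_0_interval r Hr). apply filter_imp. intros t Ht.
  rewrite (Cpower_series_shift a r M t Hb) by (rewrite Rabs_pos_eq; lra).
  rewrite RtoC_mult. ring.
- apply (filterlim_Cmult (at_right 0)).
  + apply (filterlim_RtoC (at_right 0)), filterlim_mult_ln.
  + exact (filterlim_Cpower_series_0 (fun n => a (S n)) r _ Hr Hb').
Qed.

(** * Coefficients of u_0 and of its dual, and their differential relations *)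

Definition hyp_coef (lambda : C) (n : nat) : C :=
  rising lambda n * rising (- lambda) n / (rising 1 n * INR (fact n)).

(** The Taylor coefficients of x 2F1(1 + lambda, 1 - lambda; 2; x), which is the function g. *)
Definition dual_coef (lambda : C) (n : nat) : C :=
  match n with O => 0 | S m => euler_prod lambda m / INR (S m) end.

Definition u0_dual (lambda : C) : R -> C := Cpower_series (dual_coef lambda).

Lemma rising_1 (n : nat) : rising 1 n = INR (fact n).
Proof.
induction n as [|n IH]; [reflexivity|].
simpl rising. rewrite IH. rewrite fact_simpl, mult_INR, RtoC_mult, S_INR, RtoC_plus. ring.
Qed.

Lemma fact_neq_0_C (n : nat) : RtoC (INR (fact n)) <> 0.
Proof. intros H. apply RtoC_inj in H. exact (INR_fact_neq_0 n H). Qed.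

Lemma hyp_coef_S (lambda : C) (n : nat) :
  INR (S n) * hyp_coef lambda (S n) = - lambda ^ 2 * dual_coef lambda (S n).
Proof.
(* The factors pair up as (k + lambda) (k - lambda) = k^2 (1 - lambda^2 / k^2) for 1 <= k <= n, and
   the pair k = 0 contributes - lambda^2. *)
assert (H : rising lambda (S n) * rising (- lambda) (S n) =
  - lambda ^ 2 * euler_prod lambda n * INR (fact n) ^ 2).
{ induction n as [|n IH].
  - unfold euler_prod. simpl. ring.
  - rewrite euler_prod_S, fact_simpl, mult_INR, RtoC_mult.
    change (rising lambda (S (S n))) with (rising lambda (S n) * (lambda + INR (S n))).
    change (rising (- lambda) (S (S n))) with (rising (- lambda) (S n) * (- lambda + INR (S n))).
    transitivity (rising lambda (S n) * rising (- lambda) (S n) *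
      ((lambda + INR (S n)) * (- lambda + INR (S n)))); [ring|].
    rewrite IH. field. apply RtoC_INR_S_neq_0. }
unfold hyp_coef. rewrite H, rising_1. unfold dual_coef.
rewrite fact_simpl, mult_INR, RtoC_mult. field.
split; [apply RtoC_INR_S_neq_0 | apply fact_neq_0_C].
Qed.

Lemma hyp_coef_S' (lambda : C) (n : nat) :
  hyp_coef lambda (S n) = euler_prod lambda (S n) - euler_prod lambda n.
Proof.
pose proof (hyp_coef_S lambda n) as H. unfold dual_coef in H.
replace (hyp_coef lambda (S n)) with (INR (S n) * hyp_coef lambda (S n) / INR (S n))
  by (field; apply RtoC_INR_S_neq_0).
rewrite H, euler_prod_S. field. apply RtoC_INR_S_neq_0.
Qed.

Lemma hyp_coef_0 (lambda : C) : hyp_coef lambda 0 = 1.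
Proof. unfold hyp_coef. simpl. field. Qed.

Lemma dual_coef_bound (lambda : C) :
  exists M : R, forall n, (Cmod (dual_coef lambda n) * 1 ^ n <= M)%R.
Proof.
destruct (euler_prod_bound lambda) as [B [HB HBn]]. exists B.
intros [|n]; rewrite pow1, Rmult_1_r; unfold dual_coef.
- rewrite Cmod_0. lra.
- rewrite Cmod_div by apply RtoC_INR_S_neq_0. rewrite Cmod_RtoC_nonneg by apply pos_INR.
  assert (1 <= INR (S n))%R by (rewrite S_INR; pose proof (pos_INR n); lra).
  apply (Rmult_le_reg_r (INR (S n))); [lra|].
  replace (Cmod (euler_prod lambda n) / INR (S n) * INR (S n))%R
    with (Cmod (euler_prod lambda n)) by (field; lra).
  specialize (HBn n). nra.
Qed.

Lemma hyp_coef_summable (lambda : C) :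
  exists M : nat -> R, ex_series M /\ (forall n, Cmod (hyp_coef lambda n) <= M n)%R.
Proof.
destruct (euler_prod_bound lambda) as [B [HB HBn]].
exists (fun n => match n with O => 1 | S m => Cmod lambda ^ 2 * B * / INR (S m) ^ 2 end)%R.
split.
- apply (@ex_series_incr_1 R_AbsRing R_NormedModule).
  apply (@ex_series_scal R_AbsRing R_NormedModule (Cmod lambda ^ 2 * B)%R), ex_series_inv_sqr.
- intros [|n].
  + rewrite hyp_coef_0, Cmod_1. lra.
  + rewrite hyp_coef_S', euler_prod_S.
    replace (_ - _) with (- (lambda ^ 2) * euler_prod lambda n * / RtoC (INR (S n)) ^ 2)
      by (unfold Cdiv; ring).
    rewrite !Cmod_mult, Cmod_opp, Cmod_inv by (apply Cpow_nz, RtoC_INR_S_neq_0).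
    rewrite !Cmod_pow, (Cmod_RtoC_nonneg (INR _)) by apply pos_INR.
    apply Rmult_le_compat_r; [apply Rlt_le, Rinv_0_lt_compat, pow_lt, lt_0_INR; lia|].
    apply Rmult_le_compat_l; [apply pow2_ge_0 | apply HBn].
Qed.

Lemma hyp_coef_bound (lambda : C) :
  exists M : R, forall n, (Cmod (hyp_coef lambda n) * 1 ^ n <= M)%R.
Proof.
destruct (euler_prod_bound lambda) as [B [HB HBn]]. exists (1 + 2 * B)%R.
intros [|n]; rewrite pow1, Rmult_1_r.
- rewrite hyp_coef_0, Cmod_1. lra.
- rewrite hyp_coef_S'. unfold Cminus. eapply Rle_trans; [apply Cmod_triangle|].
  rewrite Cmod_opp. pose proof (HBn n). pose proof (HBn (S n)). lra.
Qed.

Lemma is_series_hyp_coef (lambda : C) : is_series (hyp_coef lambda) (Delta2 lambda).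
Proof.
apply (filterlim_ext (euler_prod lambda)); [|apply euler_prod_lim].
intros n. symmetry. induction n as [|n IH].
- rewrite sum_O. apply hyp_coef_0.
- rewrite sum_Sn, IH, hyp_coef_S'.
  change (euler_prod lambda n + (euler_prod lambda (S n) - euler_prod lambda n)
    = euler_prod lambda (S n)). ring.
Qed.

(** Absolute convergence makes this the easy case of Abel's theorem: for t in (0,1) the terms are
    dominated by [M] uniformly in t. *)
Lemma filterlim_abel (a : nat -> C) (M : nat -> R) :
  ex_series M -> (forall n, Cmod (a n) <= M n)%R ->
  filterlim (Cpower_series a) (at_left 1) (locally (CSeries a)).
Proof.
intros HM Ha.
apply (filterlim_CSeries_dominated (at_left 1) _ _ M HM).
- generalize at_left_1_interval. apply filter_imp. intros t Ht n.
  rewrite Cmod_mult, Cmod_pow, Cmod_RtoC_nonneg by lra.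
  rewrite <- (Rmult_1_r (M n)). apply Rmult_le_compat; try apply Cmod_ge_0; try apply Ha.
  + apply pow_le. lra.
  + rewrite <- (pow1 n). apply pow_incr. lra.
- intros n.
  cut (filterlim (fun t => a n * RtoC t ^ n) (at_left 1) (locally (a n * RtoC (1 ^ n)))).
  { now rewrite pow1, Cmult_1_r. }
  apply (filterlim_Cmult (at_left 1)); [apply filterlim_const|].
  apply (filterlim_ext (fun t => RtoC (t ^ n))); [intros t; apply RtoC_pow|].
  apply (filterlim_RtoC (at_left 1)), (filterlim_filter_le_1 _ (@filter_le_within R (locally 1%R) _ (fun t => t < 1)%R)).
  apply continuity_pt_filterlim, derivable_continuous_pt, derivable_pt_pow.
Qed.

Lemma u0_lim_1 (lambda : C) : filterlim (u0 lambda) (at_left 1) (locally (Delta2 lambda)).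
Proof.
destruct (hyp_coef_summable lambda) as [M [HM Hle]].
rewrite <- (CSeries_unique _ _ (is_series_hyp_coef lambda)).
exact (filterlim_abel _ M HM Hle).
Qed.

Lemma u0_derive (lambda : C) (t : R) :
  (0 < t < 1)%R -> exists d, is_Cderive (u0 lambda) t d /\ t * d = - lambda ^ 2 * u0_dual lambda t.
Proof.
intros Ht. destruct (hyp_coef_bound lambda) as [M HM].
assert (Ht' : (Rabs t < 1)%R) by (rewrite Rabs_pos_eq; lra).
exists (Cpower_series (Cps_derive (hyp_coef lambda)) t). split.
- exact (is_Cderive_Cpower_series _ 1 M HM t Ht').
- destruct (dual_coef_bound lambda) as [M' HM'].
  unfold u0_dual. rewrite (Cpower_series_shift _ 1 M' t HM' Ht').
  simpl (dual_coef lambda 0).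
  replace (- lambda ^ 2 * (0 + t * Cpower_series (fun n => dual_coef lambda (S n)) t))
    with (t * (- lambda ^ 2 * Cpower_series (fun n => dual_coef lambda (S n)) t)) by ring.
  f_equal. apply CSeries_unique.
  apply (is_series_ext (fun n => - lambda ^ 2 * (dual_coef lambda (S n) * RtoC t ^ n))).
  + intros n. unfold Cps_derive. rewrite hyp_coef_S. C_eq. ring.
  + apply is_series_Cmult_l.
    apply (is_series_Cpower_series _ 1 M'); [|exact Ht'].
    intros n. specialize (HM' (S n)). rewrite pow1 in *. exact HM'.
Qed.

(** The derivative is the sum of P_n t^n; multiplying by 1 - t takes differences of the P_n, which
    are the coefficients of u_0. *)
Lemma u0_dual_derive (lambda : C) (t : R) :
  (0 < t < 1)%R -> exists d, is_Cderive (u0_dual lambda) t d /\ (1 - t) * d = u0 lambda t.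
Proof.
intros Ht. destruct (dual_coef_bound lambda) as [M HM].
assert (Ht' : (Rabs t < 1)%R) by (rewrite Rabs_pos_eq; lra).
exists (Cpower_series (Cps_derive (dual_coef lambda)) t). split.
- exact (is_Cderive_Cpower_series _ 1 M HM t Ht').
- pose proof (is_series_Cps_derive _ 1 M HM t Ht') as H.
  set (p := Cpower_series (Cps_derive (dual_coef lambda)) t) in *.
  assert (E : forall n, Cps_derive (dual_coef lambda) n = euler_prod lambda n).
  { intros n. unfold Cps_derive, dual_coef. field. apply RtoC_INR_S_neq_0. }
  symmetry. apply CSeries_unique.
  replace ((1 - t) * p) with (hyp_coef lambda 0 * RtoC t ^ 0 + (p - 1 - t * p))
    by (rewrite hyp_coef_0; simpl; ring).
  apply (is_series_Cshift (fun n => hyp_coef lambda n * RtoC t ^ n)).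
  apply (is_series_ext (fun n => Cps_derive (dual_coef lambda) (S n) * RtoC t ^ S n -
    t * (Cps_derive (dual_coef lambda) n * RtoC t ^ n))).
  + intros n. rewrite !E, hyp_coef_S', Cpow_S. C_eq. ring.
  + apply is_series_Cminus; [|now apply is_series_Cmult_l].
    apply (@is_series_incr_1 C_AbsRing C_NormedModule
      (fun n => Cps_derive (dual_coef lambda) n * RtoC t ^ n)).
    assert (E1 : p - 1 + Cps_derive (dual_coef lambda) 0 * RtoC t ^ 0 = p)
      by (rewrite E; unfold euler_prod; simpl; ring).
    rewrite <- E1 in H. exact H.
Qed.

(** * The sum of (P_n - P) / (n + 1) *)

(* [(M + n)!^2 / (n! (2 M + 1 + n)!)]: the Gauss-type weights whose sums against
   [euler_prod] telescope in [M]. *)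
Fixpoint gauss_weight (M n : nat) : R :=
  match M with
  | O => / INR (S n)
  | S M' => gauss_weight M' n * INR (S M' + n) ^ 2 /
      (INR (2 * S M' + n) * INR (2 * S M' + n + 1))
  end%R.

(** Together with the recursion on M in the definition, this ratio in n is all that the telescoping
    identity uses about the factorials. *)
Lemma gauss_weight_S_r (M n : nat) :
  gauss_weight M (S n) =
  (gauss_weight M n * INR (S M + n) ^ 2 / (INR (S n) * INR (2 * S M + n)))%R.
Proof.
induction M as [|M IH].
- cbn [gauss_weight]. rewrite !plus_INR, mult_INR, !S_INR. pose proof (pos_INR n).
  simpl INR. field. lra.
- cbn [gauss_weight]. rewrite IH. rewrite !plus_INR, !mult_INR, !S_INR. simpl (INR 0).
  pose proof (pos_INR n). pose proof (pos_INR M). field. lra.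
Qed.

(** One step in M multiplies the weight by (M+n+1)^2 / ((2M+2+n) (2M+3+n)), which is at most (M+n+1)
    / (M+n+2). *)
Lemma gauss_weight_bound (M n : nat) : (0 <= gauss_weight M n <= / INR (S (M + n)))%R.
Proof.
induction M as [|M IH].
- cbn [gauss_weight]. split; [|apply Rle_refl].
  apply Rlt_le, Rinv_0_lt_compat, lt_0_INR; lia.
- cbn [gauss_weight]. rewrite !plus_INR, !mult_INR, !S_INR in *. rewrite !plus_INR in *.
  simpl (INR 0). rewrite S_INR in *.
  pose proof (pos_INR n). pose proof (pos_INR M). set (x := INR M) in *. set (y := INR n) in *.
  set (w := gauss_weight M n) in *.
  assert (Hd : (0 < (((0 + 1 + 1) * (x + 1) + y) * ((0 + 1 + 1) * (x + 1) + y + (0 + 1))))%R) by nra.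
  split.
  + apply Rmult_le_pos; [apply Rmult_le_pos; [apply IH | apply pow2_ge_0]|].
    now apply Rlt_le, Rinv_0_lt_compat.
  + apply (Rmult_le_reg_r _ _ _ Hd). unfold Rdiv. rewrite Rmult_assoc, Rinv_l, Rmult_1_r by lra.
    apply Rle_trans with (/ (x + y + 1) * (x + 1 + y) ^ 2)%R.
    * apply Rmult_le_compat_r; [apply pow2_ge_0 | apply IH].
    * apply (Rmult_le_reg_r (x + 1 + y + 1)); [lra|].
      replace (/ (x + y + 1) * (x + 1 + y) ^ 2 * (x + 1 + y + 1))%R
        with ((x + 1 + y) * (x + 1 + y + 1))%R by (field; lra).
      replace (/ (x + 1 + y + 1) * _ * (x + 1 + y + 1))%R
        with (((0 + 1 + 1) * (x + 1) + y) * ((0 + 1 + 1) * (x + 1) + y + (0 + 1)))%R by (field; lra).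
      nra.
Qed.

Lemma is_lim_seq_inv_INR_plus (a : R) : is_lim_seq (fun n => / (INR n + a))%R 0.
Proof.
apply (is_lim_seq_inv _ p_infty); [|discriminate].
apply (is_lim_seq_plus _ _ p_infty a p_infty); [apply is_lim_seq_INR | apply is_lim_seq_const | reflexivity].
Qed.

Lemma is_lim_seq_ratio (a b : R) : (0 < b)%R -> is_lim_seq (fun n => (INR n + a) / (INR n + b))%R 1.
Proof.
intros Hb. apply (is_lim_seq_ext (fun n => 1 + (a - b) * / (INR n + b))%R).
- intros n. pose proof (pos_INR n). field. lra.
- replace (Finite 1) with (Finite (1 + (a - b) * 0)) by (f_equal; ring).
  apply is_lim_seq_plus'; [apply is_lim_seq_const|].
  apply (is_lim_seq_mult' (fun _ => a - b)%R); [apply is_lim_seq_const | apply is_lim_seq_inv_INR_plus].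
Qed.

Lemma gauss_weight_lim (M : nat) : is_lim_seq (fun n => INR n * gauss_weight M n)%R 1.
Proof.
induction M as [|M IH].
- apply (is_lim_seq_ext (fun n => (INR n + 0) / (INR n + 1))%R); [|apply is_lim_seq_ratio; lra].
  intros n. cbn [gauss_weight]. rewrite S_INR. unfold Rdiv. ring.
- set (x := INR (S M)). assert (Hx : (0 < x)%R) by (apply lt_0_INR; lia).
  apply (is_lim_seq_ext (fun n => (INR n * gauss_weight M n) *
    (((INR n + x) / (INR n + 2 * x)) * ((INR n + x) / (INR n + (2 * x + 1)))))%R).
  + intros n. cbn [gauss_weight]. rewrite !plus_INR, mult_INR. fold x. simpl (INR 2). simpl (INR 1).
    pose proof (pos_INR n). field. lra.
  + replace (Finite 1) with (Finite (1 * (1 * 1))) by (f_equal; ring).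
    apply is_lim_seq_mult'; [exact IH|].
    apply is_lim_seq_mult'; apply is_lim_seq_ratio; lra.
Qed.

(** The n-th term of S_M. At M = 0 the weight is 1 / (n + 1), so the series is K. *)
Definition weighted_defect (lambda : C) (M n : nat) : C :=
  (euler_prod lambda (M + n) - Delta2 lambda) * gauss_weight M n.

(** One factor 1 / (M+n+1) comes from the rate of the Euler product, the other from the weight. The
    bound is summable in n uniformly in M, and tends to 0 as M grows. *)
Lemma weighted_defect_bound (lambda : C) :
  exists B : R, (0 < B)%R /\ forall M n,
    (Cmod (weighted_defect lambda M n) <= B * / INR (S (M + n)) ^ 2)%R.
Proof.
destruct (euler_prod_rate lambda) as [B [HB HBn]]. exists B. split; [exact HB|].
intros M n. unfold weighted_defect. rewrite Cmod_mult.
destruct (gauss_weight_bound M n) as [H0 H1]. rewrite Cmod_RtoC_nonneg by assumption.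
assert (Hp : (INR (S (M + n)) <> 0)%R) by (apply not_0_INR; lia).
replace (B * / INR (S (M + n)) ^ 2)%R with (B / INR (S (M + n)) * / INR (S (M + n)))%R
  by (field; exact Hp).
apply Rmult_le_compat; [apply Cmod_ge_0 | assumption | apply HBn | assumption].
Qed.

Lemma inv_sqr_INR_le (m n : nat) :
  (n <= m)%nat -> (/ INR (S m) ^ 2 <= / INR (S n) ^ 2)%R.
Proof.
intros H. apply Rinv_le_contravar.
- apply pow_lt, lt_0_INR. lia.
- apply pow_incr. split; [apply pos_INR | apply le_INR; lia].
Qed.

Lemma is_series_weighted_defect (lambda : C) (M : nat) :
  is_series (weighted_defect lambda M) (CSeries (weighted_defect lambda M)).
Proof.
destruct (weighted_defect_bound lambda) as [B [HB HBn]].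
apply (is_series_CSeries _ (fun n => B * / INR (S n) ^ 2)%R).
- intros n. eapply Rle_trans; [apply HBn|].
  apply Rmult_le_compat_l; [lra | apply inv_sqr_INR_le; lia].
- apply (@ex_series_scal R_AbsRing R_NormedModule B), ex_series_inv_sqr.
Qed.

Lemma CSeries_weighted_defect_lim (lambda : C) :
  filterlim (fun M => CSeries (weighted_defect lambda M)) eventually (locally (RtoC 0)).
Proof.
destruct (weighted_defect_bound lambda) as [B [HB HBn]].
replace (RtoC 0) with (CSeries (fun _ => 0)).
- apply (filterlim_CSeries_dominated eventually _ _ (fun n => B * / INR (S n) ^ 2)%R).
  + apply (@ex_series_scal R_AbsRing R_NormedModule B), ex_series_inv_sqr.
  + apply filter_forall. intros M n. eapply Rle_trans; [apply HBn|].
    apply Rmult_le_compat_l; [lra | apply inv_sqr_INR_le; lia].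
  + intros n. apply (filterlim_C_squeeze eventually _ _ (fun M => B * / (INR M + 1))%R).
    * apply filter_forall. intros M.
      replace (weighted_defect lambda M n - 0) with (weighted_defect lambda M n) by ring.
      eapply Rle_trans; [apply HBn|]. apply Rmult_le_compat_l; [lra|].
      eapply Rle_trans; [apply (inv_sqr_INR_le _ M); lia|]. rewrite S_INR.
      pose proof (pos_INR M). apply Rinv_le_contravar; [lra | nra].
    * assert (H : is_lim_seq (fun M => B * / (INR M + 1))%R (B * 0)%R).
      { apply (is_lim_seq_mult' (fun _ => B)); [apply is_lim_seq_const | apply is_lim_seq_inv_INR_plus]. }
      rewrite Rmult_0_r in H. exact H.
- unfold CSeries. simpl. unfold Series.
  assert (E : Lim_seq (sum_n (fun _ => 0%R)) = 0%R).
  { rewrite (Lim_seq_ext _ (fun _ => 0%R)); [apply Lim_seq_const|].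
    intros n. exact (@sum_n_m_const_zero R_AbelianMonoid 0 n). }
  rewrite E. reflexivity.
Qed.

Lemma RtoC_pos_neq_0 (x : R) : (0 < x)%R -> RtoC x <> 0.
Proof. intros Hx H. apply RtoC_inj in H. lra. Qed.

(** * Single zeta values and geometric series *)

Lemma mzv_trunc_single_S (a N : nat) :
  mzv_trunc (a :: nil) 0 (S N) = (mzv_trunc (a :: nil) 0 N + / INR (S N) ^ a)%R.
Proof.
transitivity (mzv_trunc (a :: nil) 0 N + / INR (S N) ^ a * 1)%R; [|ring].
exact (@sum_n_Sm R_AbelianMonoid (fun n => / INR n ^ a * 1)%R 1 N ltac:(lia)).
Qed.

(** Comparison with exponent 2, where [mzv_trunc_twos_bound] at r = k = 1 gives [exp 2]. Uniformity
    in a lets the series of odd zeta values be dominated by a geometric one. *)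
Lemma mzv_trunc_single_bound (a N : nat) :
  (2 <= a)%nat -> (mzv_trunc (a :: nil) 0 N <= exp 2)%R.
Proof.
intros Ha. apply Rle_trans with (mzv_trunc (2%nat :: nil) 0 N).
- induction N as [|N IH]; [apply Rle_refl|].
  rewrite !mzv_trunc_single_S. apply Rplus_le_compat; [exact IH|].
  apply Rinv_le_contravar; [apply pow_lt, lt_0_INR; lia|].
  apply Rle_pow; [|exact Ha]. rewrite S_INR. pose proof (pos_INR N). lra.
- pose proof (mzv_trunc_twos_bound 1 1 N Rle_0_1) as H.
  rewrite pow_1, Rmult_1_l, Rmult_1_r in H. exact H.
Qed.

Lemma mzv_single_correct (a : nat) :
  (2 <= a)%nat -> is_lim_seq (fun N => mzv_trunc (a :: nil) 0 N) (mzv (a :: nil)).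
Proof.
intros Ha. apply Lim_seq_correct'. apply (ex_finite_lim_seq_incr _ (exp 2)).
- intros N. rewrite mzv_trunc_single_S.
  assert (0 <= / INR (S N) ^ a)%R
    by (apply Rlt_le, Rinv_0_lt_compat, pow_lt, lt_0_INR; lia). lra.
- intros N. now apply mzv_trunc_single_bound.
Qed.

Lemma is_series_Cgeom (q : C) : (Cmod q < 1)%R -> is_series (fun k => q ^ k) (/ (1 - q)).
Proof.
intros Hq.
assert (H : is_series (fun k => q ^ k) (CSeries (fun k => q ^ k))).
{ apply (is_series_CSeries _ (fun k => Cmod q ^ k)%R).
  - intros k. rewrite Cmod_pow. apply Rle_refl.
  - apply ex_series_geom. rewrite Rabs_pos_eq by apply Cmod_ge_0. exact Hq. }
assert (H' : is_series (fun k => q ^ k) (1 + q * CSeries (fun k => q ^ k))).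
{ apply (is_series_Cshift (fun k => q ^ k)).
  eapply is_series_ext; [|apply (is_series_Cmult_l q _ _ H)].
  intros n. C_eq. now rewrite Cpow_S. }
apply CSeries_unique in H'.
assert (Hq1 : 1 - q <> 0).
{ intros E. assert (q = 1) as -> by (replace q with (1 - (1 - q)) by ring; rewrite E; ring).
  rewrite Cmod_1 in Hq. lra. }
replace (/ (1 - q)) with (CSeries (fun k => q ^ k)); [exact H|].
transitivity ((CSeries (fun k => q ^ k) - q * CSeries (fun k => q ^ k)) / (1 - q));
  [field; exact Hq1|].
rewrite H' at 1. field. exact Hq1.
Qed.

Section Telescoping.
Variable lambda : C.
Hypothesis Hlambda : (Cmod lambda < 1)%R.

Lemma sqr_INR_minus_neq_0 (m : nat) : RtoC (INR (S m)) ^ 2 - lambda ^ 2 <> 0.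
Proof.
intros H. assert (E : RtoC (INR (S m)) ^ 2 = lambda ^ 2).
{ replace (RtoC (INR (S m)) ^ 2) with (RtoC (INR (S m)) ^ 2 - lambda ^ 2 + lambda ^ 2) by ring.
  rewrite H. ring. }
apply (f_equal Cmod) in E. rewrite !Cmod_pow, Cmod_RtoC_nonneg in E by apply pos_INR.
pose proof (Cmod_ge_0 lambda).
assert (1 <= INR (S m))%R by (rewrite S_INR; pose proof (pos_INR m); lra). nra.
Qed.

(* With [a = m + lambda] and [b = m - lambda], raising first [a] and then [b] by one in
   [Gamma(a + n) Gamma(b + n) / (n! Gamma(a + b + n))] changes it each time by an explicit
   difference in [n]; this is the sum of the two, minus its value at [lambda = 0]. *)
Definition telescoper (M n : nat) : C :=
  let m := RtoC (INR (S M)) in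
  let n' := RtoC (INR n) in
  n' * gauss_weight M n / (2 * m + n') *
  (euler_prod lambda (M + n) * (3 * m ^ 2 + lambda ^ 2 + 2 * m * n') / (m ^ 2 - lambda ^ 2) -
   Delta2 lambda * (3 * m + 2 * n') / m).

(** Both shifted weights are rational multiples of [gauss_weight M n], and P_(M+n+1) is one of
    P_(M+n). What remains is an identity of rational functions in M, n and lambda, linear in P_(M+n)
    and P. *)
Lemma weighted_defect_telescope (M n : nat) :
  weighted_defect lambda M n - weighted_defect lambda (S M) n =
  telescoper M (S n) - telescoper M n.
Proof.
unfold telescoper, weighted_defect. cbv zeta.
rewrite gauss_weight_S_r. cbn [gauss_weight].
replace (M + S n)%nat with (S (M + n)) by lia.
change (S M + n)%nat with (S (M + n)). rewrite euler_prod_S.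
pose proof (sqr_INR_minus_neq_0 M) as Hm.
pose proof (pos_INR M) as HM. pose proof (pos_INR n) as Hn.
unfold Rdiv.
rewrite !RtoC_mult, !RtoC_inv, !RtoC_mult, !RtoC_pow
  by (try apply Rmult_integral_contrapositive_currified; apply not_0_INR; lia).
rewrite ?plus_INR, ?mult_INR, ?S_INR, ?plus_INR, ?RtoC_plus, ?RtoC_mult, ?RtoC_plus in *.
change (RtoC (INR 0)) with (RtoC 0). change (INR 2) with 2%R. change (INR 1) with 1%R.
set (x := RtoC (INR M)) in *. set (y := RtoC (INR n)) in *.
set (w := RtoC (gauss_weight M n)). set (Q := euler_prod lambda (M + n)).
field.
repeat split.
all: try exact Hm.
all: unfold x, y; rewrite <- ?RtoC_plus, <- ?RtoC_mult, <- ?RtoC_plus;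
     apply RtoC_pos_neq_0; lra.
Qed.
Lemma telescoper_lim (M : nat) :
  filterlim (telescoper M) eventually
    (locally (Delta2 lambda * 2 * lambda ^ 2 /
       (RtoC (INR (S M)) * (RtoC (INR (S M)) ^ 2 - lambda ^ 2)))).
Proof.
set (m := INR (S M)). assert (Hm : (0 < m)%R) by (apply lt_0_INR; lia).
pose proof (sqr_INR_minus_neq_0 M) as Hml. fold m in Hml.
pose proof (RtoC_pos_neq_0 m Hm) as Hm0.
set (A := / (RtoC m ^ 2 - lambda ^ 2)).
set (e := fun n => RtoC (/ (INR n + 2 * m))).
assert (He : filterlim e eventually (locally (RtoC 0)))
  by apply (filterlim_RtoC eventually), is_lim_seq_inv_INR_plus.
assert (HP : filterlim (fun n => euler_prod lambda (M + n)) eventually (locally (Delta2 lambda))).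
{ apply (filterlim_comp _ _ _ (fun n => (M + n)%nat) (euler_prod lambda) eventually eventually).
  - intros Q [N HN]. exists N. intros n Hn. apply HN. lia.
  - apply euler_prod_lim. }
(* Both numerators are divided by n + 2 m with remainder, which confines the dependence on n to e n,
   P_(M+n) and n times the weight. As these tend to 0, P and 1, the limit is P (2 m / (m^2 -
   lambda^2) - 2 / m). *)
apply (filterlim_ext (fun n => RtoC (INR n * gauss_weight M n) *
  (euler_prod lambda (M + n) * (((3 * m ^ 2 + lambda ^ 2 - 4 * m ^ 2) * e n + 2 * m) * A) -
   Delta2 lambda * ((2 - m * e n) * / m)))).
- intros n. unfold telescoper. cbv zeta. fold m. unfold e, A.
  pose proof (pos_INR n).
  rewrite RtoC_mult, RtoC_inv, RtoC_plus, RtoC_mult by lra.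
  field. repeat split; try assumption;
  rewrite <- RtoC_mult, <- RtoC_plus; apply RtoC_pos_neq_0; lra.
- replace (Delta2 lambda * 2 * lambda ^ 2 / (RtoC m * (RtoC m ^ 2 - lambda ^ 2))) with
    (1 * (Delta2 lambda * (((3 * m ^ 2 + lambda ^ 2 - 4 * m ^ 2) * 0 + 2 * m) * A) -
     Delta2 lambda * ((2 - m * 0) * / m))) by (unfold A; field; split; assumption).
  pose proof (fun c : C => filterlim_const (F := eventually) c) as K.
  apply (filterlim_Cmult eventually); [apply (filterlim_RtoC eventually), gauss_weight_lim|].
  apply (filterlim_Cminus eventually).
  + apply (filterlim_Cmult eventually); [exact HP|].
    apply (filterlim_Cmult eventually); [|apply K].
    apply (filterlim_Cplus eventually); [|apply K].
    apply (filterlim_Cmult eventually); [apply K | exact He].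
  + apply (filterlim_Cmult eventually); [apply K|].
    apply (filterlim_Cmult eventually); [|apply K].
    apply (filterlim_Cminus eventually); [apply K|].
    apply (filterlim_Cmult eventually); [apply K | exact He].
Qed.

Lemma CSeries_weighted_defect_step (M : nat) :
  CSeries (weighted_defect lambda M) - CSeries (weighted_defect lambda (S M)) =
  Delta2 lambda * 2 * lambda ^ 2 /
    (RtoC (INR (S M)) * (RtoC (INR (S M)) ^ 2 - lambda ^ 2)).
Proof.
pose proof (is_series_Cminus _ _ _ _ (is_series_weighted_defect lambda M)
  (is_series_weighted_defect lambda (S M))) as H.
apply (filterlim_C_unique eventually (fun n => telescoper M (S n))).
- eapply filterlim_ext; [|exact H]. intros n. cbv beta.
  induction n as [|n IH].
  (* The lower boundary term vanishes because [telescoper M n] carries a factor n. *)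
  + rewrite sum_O, weighted_defect_telescope. unfold telescoper at 2. cbv zeta.
    simpl (INR 0). C_eq. unfold Cdiv. ring.
  + rewrite sum_Sn, IH, weighted_defect_telescope. unfold plus; simpl. C_eq. ring.
- apply (filterlim_comp _ _ _ S (telescoper M) eventually eventually).
  + intros Q [N HN]. exists N. intros n Hn. apply HN. lia.
  + apply telescoper_lim.
Qed.

(** Each fraction is lambda^2 / m^3 times the geometric series of ratio lambda^2 / m^2. Truncating
    at m <= N adds only finitely many series, so no double series has to be rearranged. *)
Lemma is_series_odd_zeta_trunc (N : nat) :
  is_series (fun k => RtoC (mzv_trunc (2 * k + 3 :: nil)%nat 0 N) * lambda ^ (2 * k + 2))
    (sum_n_m (fun m => lambda ^ 2 / (RtoC (INR m) * (RtoC (INR m) ^ 2 - lambda ^ 2))) 1 N).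
Proof.
induction N as [|N IH].
- rewrite sum_n_m_zero by lia. apply (is_series_ext (fun _ => RtoC 0)).
  + intros k. change (mzv_trunc (2 * k + 3 :: nil)%nat 0 0) with 0%R. C_eq. ring.
  + apply is_series_C. split; apply (filterlim_ext (fun _ => 0%R)); try apply filterlim_const;
      intros n; symmetry; exact (@sum_n_m_const_zero R_AbelianMonoid 0 n).
- rewrite sum_n_Sm by lia.
  set (m := INR (S N)). assert (Hm : (0 < m)%R) by (apply lt_0_INR; lia).
  pose proof (sqr_INR_minus_neq_0 N) as Hml. fold m in Hml.
  pose proof (RtoC_pos_neq_0 m Hm) as Hm0.
  set (q := lambda ^ 2 / RtoC m ^ 2).
  assert (Hq : (Cmod q < 1)%R).
  { unfold q. rewrite Cmod_div by (now apply Cpow_nz). rewrite !Cmod_pow, Cmod_RtoC_nonneg by lra.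
    assert (1 <= m)%R by (unfold m; rewrite S_INR; pose proof (pos_INR N); lra).
    pose proof (Cmod_ge_0 lambda).
    apply (Rmult_lt_reg_r (m ^ 2)); [nra|]. unfold Rdiv.
    rewrite Rmult_assoc, Rinv_l, Rmult_1_r, Rmult_1_l by nra. nra. }
  pose proof (is_series_Cmult_l (lambda ^ 2 / RtoC m ^ 3) _ _ (is_series_Cgeom q Hq)) as H.
  pose proof (is_series_Cplus _ _ _ _ IH H) as H'.
  replace (lambda ^ 2 / RtoC m ^ 3 * / (1 - q)) with
    (lambda ^ 2 / (RtoC m * (RtoC m ^ 2 - lambda ^ 2))) in H'.
  2: { unfold q. field. repeat split; assumption. }
  eapply is_series_ext; [|exact H']. intros k. C_eq. cbv beta.
  rewrite mzv_trunc_single_S, RtoC_plus, RtoC_inv by (apply pow_nonzero; fold m; lra).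
  rewrite RtoC_pow. fold m. unfold q, Cdiv.
  rewrite Cpow_mult_l, Cpow_inv, !Cpow_add_r, !Cpow_mult_r by (now apply Cpow_nz).
  field. split; [exact Hm0|]. now apply Cpow_nz, Cpow_nz.
Qed.

Lemma is_series_odd_zeta :
  exists s : C,
    is_series (fun k => mzv (2 * k + 3 :: nil)%nat * lambda ^ (2 * k + 2)) s /\
    CSeries (weighted_defect lambda 0) = Delta2 lambda * 2 * s.
Proof.
set (q := (Cmod lambda ^ 2)%R).
assert (Hq : (0 <= q < 1)%R).
{ split; [apply pow2_ge_0|]. unfold q. pose proof (Cmod_ge_0 lambda). nra. }
set (Mb := fun k : nat => (exp 2 * q ^ k)%R).
assert (HMb : ex_series Mb).
{ apply (@ex_series_scal R_AbsRing R_NormedModule), ex_series_geom. rewrite Rabs_pos_eq; lra. }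
set (b := fun k => mzv (2 * k + 3 :: nil)%nat * lambda ^ (2 * k + 2)).
set (a := fun N k => RtoC (mzv_trunc (2 * k + 3 :: nil)%nat 0 N) * lambda ^ (2 * k + 2)).
assert (Ha : forall N k, (Cmod (a N k) <= Mb k)%R).
{ intros N k. unfold a, Mb. rewrite Cmod_mult, Cmod_pow, Cmod_RtoC_nonneg by apply mzv_trunc_nonneg.
  apply Rmult_le_compat.
  - apply mzv_trunc_nonneg.
  - apply pow_le, Cmod_ge_0.
  - apply mzv_trunc_single_bound. lia.
  - rewrite pow_add, pow_mult. fold q. rewrite <- (Rmult_1_r (q ^ k)) at 2.
    apply Rmult_le_compat_l; [apply pow_le|]; lra. }
assert (Hab : forall k, filterlim (fun N => a N k) eventually (locally (b k))).
{ intros k. apply (filterlim_Cmult eventually); [|apply filterlim_const].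
  apply (filterlim_RtoC eventually), mzv_single_correct. lia. }
exists (CSeries b). split.
- apply (is_series_CSeries _ Mb); [|exact HMb]. intros k.
  apply (filterlim_Cmod_le eventually _ _ _ (Hab k)), filter_forall. intros N. apply Ha.
- assert (Hsum : forall N, CSeries (weighted_defect lambda 0) -
    CSeries (weighted_defect lambda N) = Delta2 lambda * 2 * CSeries (a N)).
  { intros N. unfold a.
    rewrite (CSeries_unique _ _ (is_series_odd_zeta_trunc N)). clear - Hlambda.
    induction N as [|N IH].
    - rewrite sum_n_m_zero by lia. C_eq. change (@zero _) with (RtoC 0). ring.
    - rewrite sum_n_Sm by lia.
      replace (CSeries (weighted_defect lambda 0) - CSeries (weighted_defect lambda (S N)))
        with ((CSeries (weighted_defect lambda 0) - CSeries (weighted_defect lambda N)) +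
              (CSeries (weighted_defect lambda N) - CSeries (weighted_defect lambda (S N)))) by ring.
      rewrite IH, CSeries_weighted_defect_step.
      unfold plus; simpl. C_eq. unfold Cdiv. ring. }
  apply (filterlim_C_unique eventually (fun N => Delta2 lambda * 2 * CSeries (a N))).
  + apply (filterlim_ext (fun N => CSeries (weighted_defect lambda 0) -
      CSeries (weighted_defect lambda N))); [exact Hsum|].
    cut (filterlim (fun N => CSeries (weighted_defect lambda 0) -
      CSeries (weighted_defect lambda N)) eventually
      (locally (CSeries (weighted_defect lambda 0) - 0))).
    { now replace (CSeries (weighted_defect lambda 0) - 0)
        with (CSeries (weighted_defect lambda 0)) by ring. }
    apply (filterlim_Cminus eventually); [apply filterlim_const | apply CSeries_weighted_defect_lim].
  + apply (filterlim_Cmult eventually); [apply filterlim_const|].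
    apply (filterlim_CSeries_dominated eventually _ _ Mb HMb); [|exact Hab].
    apply filter_forall. exact Ha.
Qed.

End Telescoping.

(** * Wronskians and the second solution *)

(** The differential equation with the Euler derivative v exposed, where [solves_hyp_eq] binds it
    existentially: the Wronskian u v' - u' v is formed from it. *)
Definition hyp_pair (lambda : C) (u v : R -> C) : Prop :=
  is_eulerD u v /\ exists w : R -> C, is_eulerD v w /\
    forall t : R, (0 < t < 1)%R -> (1 - t) * w t + lambda ^ 2 * t * u t = 0.

Lemma one_minus_neq_0 (t : R) : (0 < t < 1)%R -> 1 - RtoC t <> 0.
Proof. intros Ht H. rewrite <- RtoC_minus in H. apply RtoC_inj in H. lra. Qed.

(** The equation has no term of first order in the Euler derivative D, so D (u Du' - u' Du) = u D^2
    u' - u' D^2 u = 0. *)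
Lemma wronskian_constant (lambda : C) (u v u' v' : R -> C) :
  hyp_pair lambda u v -> hyp_pair lambda u' v' ->
  exists c : C, forall t, (0 < t < 1)%R -> u t * v' t - u' t * v t = c.
Proof.
intros [Hu [w [Hv Hw]]] [Hu' [w' [Hv' Hw']]].
apply (is_Cderive_0_constant (fun t => u t * v' t - u' t * v t)). intros t Ht.
destruct (Hu t Ht) as [du [Du Eu]], (Hv t Ht) as [dv [Dv Ev]],
  (Hu' t Ht) as [du' [Du' Eu']], (Hv' t Ht) as [dv' [Dv' Ev']].
specialize (Hw t Ht). specialize (Hw' t Ht).
assert (Ht0 : RtoC t <> 0) by (apply RtoC_pos_neq_0; lra).
assert (Ht1 : 1 - t <> 0) by now apply one_minus_neq_0.
assert (E : du * v' t + u t * dv' + RtoC (-1) * (du' * v t + u' t * dv) = 0).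
{ transitivity ((u t * ((1 - t) * (t * dv')) - u' t * ((1 - t) * (t * dv)) +
    (1 - t) * (t * du * v' t - t * du' * v t)) / (t * (1 - t))).
  - field. split; assumption.
  - rewrite <- Ev, <- Ev', <- Eu, <- Eu'.
    replace ((1 - t) * w' t) with ((1 - t) * w' t + lambda ^ 2 * t * u' t - lambda ^ 2 * t * u' t) by ring.
    replace ((1 - t) * w t) with ((1 - t) * w t + lambda ^ 2 * t * u t - lambda ^ 2 * t * u t) by ring.
    rewrite Hw, Hw'. field. split; assumption. }
rewrite <- E.
apply (@is_derive_ext R_AbsRing C_R_NormedModule (fun t => u t * v' t + RtoC (-1) * (u' t * v t))).
{ intros s. C_eq. ring. }
apply is_Cderive_plus; [|apply is_Cderive_scal]; now apply is_Cderive_mult.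
Qed.

Lemma is_derive_one_minus (t : R) : is_derive (fun x => 1 - x)%R t (-1)%R.
Proof. auto_derive; [exact I | ring]. Qed.

Lemma hyp_pair_u0 (lambda : C) :
  hyp_pair lambda (u0 lambda) (fun t => - lambda ^ 2 * u0_dual lambda t).
Proof.
split.
- intros t Ht. destruct (u0_derive lambda t Ht) as [d [Hd E]]. exists d. now rewrite E.
- exists (fun t : R => - lambda ^ 2 * t * u0 lambda t / (1 - t)). split.
  + intros t Ht. destruct (u0_dual_derive lambda t Ht) as [d [Hd E]].
    exists (- lambda ^ 2 * d). split; [now apply is_Cderive_scal|].
    rewrite <- E. field. now apply one_minus_neq_0.
  + intros t Ht. field. now apply one_minus_neq_0.
Qed.

(* The reflection [t -> 1 - t] exchanges [u0] and its dual, up to sign: this is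
   the solution vanishing at [t = 1]. *)
Lemma hyp_pair_dual (lambda : C) :
  hyp_pair lambda (fun t => u0_dual lambda (1 - t)) (fun t => - u0 lambda (1 - t)).
Proof.
split.
- intros t Ht. destruct (u0_dual_derive lambda (1 - t) ltac:(lra)) as [d [Hd E]].
  exists (RtoC (-1) * d). split.
  + apply is_Cderive_comp; [exact Hd | apply is_derive_one_minus].
  + rewrite <- E, RtoC_minus. ring.
- exists (fun t : R => - lambda ^ 2 * t * u0_dual lambda (1 - t) / (1 - t)). split.
  + intros t Ht. destruct (u0_derive lambda (1 - t) ltac:(lra)) as [d [Hd E]].
    exists d. split.
    * replace d with (RtoC (-1) * (RtoC (-1) * d)) by ring.
      apply (@is_derive_ext R_AbsRing C_R_NormedModule (fun t => RtoC (-1) * u0 lambda (1 - t))).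
      { intros s. C_eq. ring. }
      apply is_Cderive_scal, is_Cderive_comp; [exact Hd | apply is_derive_one_minus].
    * assert (Ht1 : 1 - t <> 0) by now apply one_minus_neq_0.
      rewrite RtoC_minus in E.
      transitivity (t * (- lambda ^ 2 * u0_dual lambda (1 - t)) / (1 - t));
        [field; exact Ht1|].
      rewrite <- E. field. exact Ht1.
  + intros t Ht. field. now apply one_minus_neq_0.
Qed.

(** Since - ln t is the sum of (1 - t)^n / n, the function is a power series in 1 - t with
    coefficients (P_(n-1) - P) / n. These are absolutely summable, so Abel's theorem applies. *)
Lemma u0_dual_log_lim (lambda : C) :
  filterlim (fun t => u0_dual lambda (1 - t) + Delta2 lambda * ln t) (at_right 0)
    (locally (CSeries (weighted_defect lambda 0))).
Proof.
set (d := fun n => dual_coef lambda n - Delta2 lambda * RtoC (/ INR n)).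
(* Here [/ INR 0] is 0, so the logarithmic series also starts at n = 1. *)
assert (Hd0 : d 0%nat = 0) by (unfold d; simpl; rewrite Rinv_0; ring).
assert (HdS : forall n, d (S n) = weighted_defect lambda 0 n).
{ intros n. unfold d, dual_coef, weighted_defect. cbn [gauss_weight Nat.add].
  rewrite RtoC_inv by (apply not_0_INR; lia). field. apply RtoC_INR_S_neq_0. }
assert (Hd : CSeries d = CSeries (weighted_defect lambda 0)).
{ apply CSeries_unique.
  replace (CSeries _) with (d 0%nat + CSeries (weighted_defect lambda 0)) by (rewrite Hd0; ring).
  apply is_series_Cshift.
  eapply is_series_ext; [|apply is_series_weighted_defect]. intros n. now rewrite HdS. }
rewrite <- Hd.
destruct (weighted_defect_bound lambda) as [B [HB HBn]].
apply (filterlim_ext_loc (fun t => Cpower_series d (1 - t))).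
- generalize (at_right_0_interval 1 Rlt_0_1). apply filter_imp. intros t Ht.
  assert (Hs : (Rabs (1 - t) < 1)%R) by (rewrite Rabs_pos_eq; lra).
  destruct (dual_coef_bound lambda) as [M HM].
  assert (Hinv : forall n, (Cmod (RtoC (/ INR n)) * 1 ^ n <= 1)%R).
  { intros [|n]; rewrite pow1, Rmult_1_r, Cmod_R.
    - simpl. rewrite Rinv_0, Rabs_R0. lra.
    - assert (1 <= INR (S n))%R by (rewrite S_INR; pose proof (pos_INR n); lra).
      rewrite Rabs_pos_eq by (apply Rlt_le, Rinv_0_lt_compat; lra).
      rewrite <- Rinv_1. apply Rinv_le_contravar; lra. }
  assert (Hln : Cpower_series (fun n => RtoC (/ INR n)) (1 - t) = - RtoC (ln t)).
  { rewrite Cpower_series_Re_Im. simpl.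
    rewrite PSeries_ln by lra. replace (1 - (1 - t))%R with t by ring.
    rewrite PSeries_const_0. unfold Copp. simpl. now rewrite Ropp_0. }
  apply CSeries_unique.
  replace (u0_dual lambda (1 - t) + Delta2 lambda * ln t) with
    (Cpower_series (dual_coef lambda) (1 - t) -
     Delta2 lambda * Cpower_series (fun n => RtoC (/ INR n)) (1 - t))
    by (rewrite Hln; unfold u0_dual; ring).
  eapply is_series_ext; [|apply is_series_Cminus;
    [apply (is_series_Cpower_series _ 1 M HM _ Hs) |
     apply is_series_Cmult_l, (is_series_Cpower_series _ 1 1 Hinv _ Hs)]].
  intros n. C_eq. unfold d. ring.
- apply (filterlim_comp _ _ _ (fun t => 1 - t)%R (Cpower_series d) _ (at_left 1));
    [apply filterlim_one_minus_at_right|].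
  apply (filterlim_abel _ (fun n => match n with O => 0 | S m => B * / INR (S m) ^ 2 end)%R).
  + apply (@ex_series_incr_1 R_AbsRing R_NormedModule).
    apply (@ex_series_scal R_AbsRing R_NormedModule B), ex_series_inv_sqr.
  + intros [|n]; [rewrite Hd0, Cmod_0; apply Rle_refl|]. rewrite HdS. apply HBn.
Qed.

(** The first factor is a convergent function minus P ln t, so X has to absorb both a constant and a
    logarithm. *)
Lemma u0_dual_mult_lim (lambda : C) (X : R -> C) :
  filterlim X (at_right 0) (locally (RtoC 0)) ->
  filterlim (fun t => X t * ln t) (at_right 0) (locally (RtoC 0)) ->
  filterlim (fun t => u0_dual lambda (1 - t) * X t) (at_right 0) (locally (RtoC 0)).
Proof.
intros HX HXl.
apply (filterlim_ext (fun t => (u0_dual lambda (1 - t) + Delta2 lambda * ln t) * X t -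
  Delta2 lambda * (X t * ln t))); [intros t; ring|].
replace (RtoC 0) with (CSeries (weighted_defect lambda 0) * 0 - Delta2 lambda * 0) by ring.
apply (filterlim_Cminus (at_right 0)); apply (filterlim_Cmult (at_right 0)); try assumption.
- apply u0_dual_log_lim.
- apply filterlim_const.
Qed.

(** A relation of Legendre type: the left-hand side is minus the Wronskian of u_0 and phi. As t
    tends to 0 the first product tends to P, while the second is of order t ln t. *)
Lemma u0_reflection (lambda : C) (t : R) :
  (0 < t < 1)%R ->
  u0 lambda t * u0 lambda (1 - t) - lambda ^ 2 * (u0_dual lambda t * u0_dual lambda (1 - t))
  = Delta2 lambda.
Proof.
destruct (wronskian_constant lambda _ _ _ _ (hyp_pair_u0 lambda) (hyp_pair_dual lambda)) as [c Hc].
destruct (dual_coef_bound lambda) as [M HM].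
destruct (hyp_coef_bound lambda) as [M' HM'].
assert (E : Delta2 lambda = - c).
{ apply (filterlim_C_unique (at_right 0) (fun t => u0 lambda t * u0 lambda (1 - t) -
    lambda ^ 2 * (u0_dual lambda (1 - t) * u0_dual lambda t))).
  - replace (Delta2 lambda) with (1 * Delta2 lambda - lambda ^ 2 * 0) by ring.
    apply (filterlim_Cminus (at_right 0)); apply (filterlim_Cmult (at_right 0)).
    + rewrite <- (hyp_coef_0 lambda).
      exact (filterlim_Cpower_series_0 (hyp_coef lambda) 1 M' Rlt_0_1 HM').
    + apply (filterlim_comp _ _ _ (fun t => 1 - t)%R (u0 lambda) _ (at_left 1));
        [apply filterlim_one_minus_at_right | apply u0_lim_1].
    + apply filterlim_const.
    + apply u0_dual_mult_lim.
      * exact (filterlim_Cpower_series_0 (dual_coef lambda) 1 M Rlt_0_1 HM).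
      * apply (filterlim_ext (fun t => (Cpower_series (dual_coef lambda) t - dual_coef lambda 0) * ln t)).
        { intros x. simpl (dual_coef lambda 0). unfold u0_dual. ring. }
        exact (filterlim_Cpower_series_ln (dual_coef lambda) 1 M Rlt_0_1 HM).
  - apply (filterlim_ext_loc (fun _ => - c)); [|apply filterlim_const].
    generalize (at_right_0_interval 1 Rlt_0_1). apply filter_imp. intros x Hx.
    rewrite <- (Hc x Hx). ring. }
intros Ht. rewrite E, <- (Hc t Ht). ring.
Qed.

(** Terms of a convergent series tend to 0; this turns the convergence supplied by [analytic_at_0]
    into the bound that the power series lemmas take as hypothesis. *)
Lemma is_series_terms_bounded (a : nat -> C) (x : R) (s : C) :
  (0 <= x)%R -> is_series (fun n => a n * RtoC x ^ n) s ->
  exists M : R, forall n, (Cmod (a n) * x ^ n <= M)%R.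
Proof.
intros Hx H.
assert (Hlim : filterlim (fun n => a n * RtoC x ^ n) eventually (locally (RtoC 0))).
{ apply is_series_C in H. destruct H as [H1 H2].
  apply (filterlim_C_Re_Im eventually). split.
  - exact (ex_series_lim_0 _ (ex_intro _ _ H1)).
  - exact (ex_series_lim_0 _ (ex_intro _ _ H2)). }
assert (Hn : is_lim_seq (fun n => Cmod (a n) * x ^ n)%R 0).
{ apply (is_lim_seq_ext (fun n => Cmod (a n * RtoC x ^ n))).
  - intros n. now rewrite Cmod_mult, Cmod_pow, Cmod_RtoC_nonneg.
  - unfold is_lim_seq. simpl. rewrite <- Cmod_0.
    apply (filterlim_comp _ _ _ _ Cmod _ _ _ Hlim).
    exact (@filterlim_norm C_AbsRing C_NormedModule (RtoC 0)). }
destruct (filterlim_bounded _ (ex_intro _ 0%R Hn)) as [M HM].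
exists M. intros n. eapply Rle_trans; [apply Rle_abs | apply HM].
Qed.

Lemma u1_lim_1 (lambda l : C) (u1 : R -> C) :
  Delta2 lambda <> 0 -> is_u1 lambda l u1 ->
  filterlim u1 (at_left 1)
    (locally (2 * Delta2 lambda * l + CSeries (weighted_defect lambda 0))).
Proof.
intros HP [[v1 [w1 [Hv1 [Hw1 Heq]]]] [ut [[a [r [Hr Ha]]] [Hut0 Hut]]]].
set (P := Delta2 lambda) in *. set (K := CSeries (weighted_defect lambda 0)).
assert (Hpair : hyp_pair lambda u1 v1) by (split; [exact Hv1 | now exists w1]).
set (f := u0 lambda). set (g := u0_dual lambda).
(* The point r / 2 lies strictly inside the disc of convergence, so the terms there are bounded. *)
assert (Hr2 : (0 < r / 2)%R) by lra.
destruct (is_series_terms_bounded a (r / 2) (ut (r / 2)%R) ltac:(lra)) as [M HM].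
{ apply Ha. rewrite Cmod_RtoC_nonneg; lra. }
assert (Hps : forall t, (0 <= t < r)%R -> ut t = Cpower_series a t).
{ intros t Ht. symmetry. apply CSeries_unique, Ha. rewrite Cmod_RtoC_nonneg; lra. }
assert (Ha0 : a 0%nat = 0).
{ rewrite <- Cpower_series_0, <- Hps by lra. exact Hut0. }
set (a' := Cpower_series (Cps_derive a)).
(* On (0, rho) both the formula for [u1] and termwise differentiation of the series of [ut] are
   available. *)
set (rho := Rmin 1 (r / 2)).
assert (Hrho : (0 < rho)%R) by (apply Rmin_glb_lt; lra).
assert (Hrho1 : (rho <= 1)%R) by apply Rmin_l.
assert (Hrho2 : (rho <= r / 2)%R) by apply Rmin_r.
(* The Euler derivative of u_0 is - lambda^2 g and that of 2 l + ln t is 1; uniqueness of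
   derivatives identifies the given [v1] with the result. *)
assert (Hv : forall t, (0 < t < rho)%R ->
  v1 t = - lambda ^ 2 * g t * (2 * l + ln t) + f t + t * a' t).
{ intros t Ht. destruct (Hv1 t ltac:(lra)) as [d [Hd ->]].
  destruct (u0_derive lambda t ltac:(lra)) as [df [Hdf Edf]]. fold f in Hdf. fold g in Edf.
  assert (Hd' : is_Cderive (fun x => f x * (2 * l + ln x) + Cpower_series a x) t
    (df * (2 * l + ln t) + f t * (0 + RtoC (/ t)) + a' t)).
  { apply is_Cderive_plus.
    - apply is_Cderive_mult; [exact Hdf|]. apply is_Cderive_plus; [apply is_Cderive_const|].
      apply is_Cderive_RtoC, is_derive_ln. lra.
    - apply (is_Cderive_Cpower_series a (r / 2) M HM). rewrite Rabs_pos_eq; lra. }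
  assert (E : d = df * (2 * l + ln t) + f t * (0 + RtoC (/ t)) + a' t).
  { apply (is_Cderive_unique u1 t); [exact Hd|].
    refine (@is_derive_ext_loc R_AbsRing C_R_NormedModule _ _ t _ _ Hd').
    apply (locally_interval _ t 0%R rho); simpl; try lra.
    intros x Hx1 Hx2. simpl in Hx1, Hx2. symmetry. rewrite Hut by lra. now rewrite Hps by lra. }
  rewrite E, <- Edf, RtoC_inv by lra. field. apply RtoC_pos_neq_0. lra. }
destruct (wronskian_constant lambda _ _ _ _ Hpair (hyp_pair_dual lambda)) as [c1 Hc1].
destruct (wronskian_constant lambda _ _ _ _ Hpair (hyp_pair_u0 lambda)) as [c2 Hc2].
assert (Ha'0 : filterlim a' (at_right 0) (locally (a' 0))).
{ apply filterlim_locally_at_right, (Cpower_series_derive_continuous a (r / 2) M HM).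
  rewrite Rabs_R0. exact Hr2. }
assert (Hid : filterlim RtoC (at_right 0) (locally (RtoC 0))).
{ apply filterlim_locally_at_right, (filterlim_RtoC (locally 0%R)), filterlim_id. }
destruct (hyp_coef_bound lambda) as [Mf HMf].
pose proof (filterlim_Cpower_series_0 _ 1 Mf Rlt_0_1 HMf) as Hf0.
pose proof (filterlim_Cpower_series_ln _ 1 Mf Rlt_0_1 HMf) as Hfln.
rewrite hyp_coef_0 in Hf0, Hfln.
pose proof (filterlim_Cpower_series_0 a (r / 2) M Hr2 HM) as Hut_lim. rewrite Ha0 in Hut_lim.
pose proof (filterlim_RtoC (at_right 0) _ _ filterlim_mult_ln) as Htln.
(* In the Wronskian of u_1 and phi, [u0_reflection] merges the terms carrying 2 l + ln t into - P (2
   l + ln t). Its ln t cancels the singularity of - phi(t), leaving - 2 P l - K and terms that tend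
   to 0. *)
assert (Hc1' : c1 = - (2 * P * l + K)).
{ apply (filterlim_C_unique (at_right 0) (fun t =>
    - (2 * P * l) - (u0_dual lambda (1 - t) + P * ln t) - Cpower_series a t * u0 lambda (1 - t) -
    u0_dual lambda (1 - t) * ((f t - 1) + t * a' t))).
  - apply (filterlim_ext_loc (fun _ => c1)); [|apply filterlim_const].
    generalize (at_right_0_interval rho Hrho). apply filter_imp. intros t Ht.
    rewrite <- (Hc1 t ltac:(lra)), (Hv t Ht), Hut, Hps by lra. fold f g.
    unfold P. rewrite <- (u0_reflection lambda t ltac:(lra)). fold f g. ring.
  - replace (- (2 * P * l + K)) with (- (2 * P * l) - K - 0 * P - 0) by ring.
    apply (filterlim_Cminus (at_right 0)); [|apply u0_dual_mult_lim].
    + apply (filterlim_Cminus (at_right 0)).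
      * apply (filterlim_Cminus (at_right 0)); [apply filterlim_const | apply u0_dual_log_lim].
      * apply (filterlim_Cmult (at_right 0)); [exact Hut_lim|].
        apply (filterlim_comp _ _ _ (fun t => 1 - t)%R (u0 lambda) _ (at_left 1));
          [apply filterlim_one_minus_at_right | apply u0_lim_1].
    + replace (RtoC 0) with ((1 - 1) + 0 * a' 0%R) by ring.
      apply (filterlim_Cplus (at_right 0)).
      * apply (filterlim_Cminus (at_right 0)); [exact Hf0 | apply filterlim_const].
      * now apply (filterlim_Cmult (at_right 0)).
    + apply (filterlim_ext (fun t => (f t - 1) * ln t + RtoC (t * ln t) * a' t)).
      { intros t. rewrite RtoC_mult. ring. }
      replace (RtoC 0) with (0 + 0 * a' 0%R) by ring.
      apply (filterlim_Cplus (at_right 0)); [exact Hfln|].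
      now apply (filterlim_Cmult (at_right 0)). }
(* The Pluecker relation between the three Wronskians expresses [u1] through [u0] and
   the solution vanishing at 1. *)
apply (filterlim_ext_loc (fun t => (u0 lambda t * (2 * P * l + K) + u0_dual lambda (1 - t) * c2) / P)).
- generalize at_left_1_interval. apply filter_imp. intros t Ht.
  replace (2 * P * l + K) with (- c1) by (rewrite Hc1'; ring).
  rewrite <- (Hc1 t Ht), <- (Hc2 t Ht). fold f g.
  transitivity (u1 t * (f t * f (1 - t)%R - lambda ^ 2 * (g t * g (1 - t)%R)) / P).
  + fold f g. field. exact HP.
  + unfold f, g. rewrite u0_reflection by exact Ht. fold P. field. exact HP.
(* As t tends to 1, the factor of [c2] tends to g(0) = 0 and u_0 tends to P, which cancels the
   denominator. *)
- cut (filterlim (fun t => (u0 lambda t * (2 * P * l + K) + u0_dual lambda (1 - t) * c2) / P)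
    (at_left 1) (locally ((P * (2 * P * l + K) + 0 * c2) * / P))).
  { now replace ((P * (2 * P * l + K) + 0 * c2) * / P) with (2 * P * l + K) by (field; exact HP). }
  apply (filterlim_Cmult (at_left 1)); [|apply filterlim_const].
  apply (filterlim_Cplus (at_left 1)); (apply (filterlim_Cmult (at_left 1)); [|apply filterlim_const]).
  + apply u0_lim_1.
  + apply (filterlim_comp _ _ _ (fun t => 1 - t)%R (u0_dual lambda) _ (locally 0%R));
      [apply filterlim_one_minus_at_left|].
    destruct (dual_coef_bound lambda) as [Mg HMg].
    replace (RtoC 0) with (u0_dual lambda 0) by (apply (Cpower_series_0 (dual_coef lambda))).
    eapply is_Cderive_continuous, (is_Cderive_Cpower_series (dual_coef lambda) 1 Mg HMg).
    rewrite Rabs_R0. apply Rlt_0_1.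
Qed.

Theorem lemma5p1 (lambda : C) :
  (filterlim (u0 lambda) (at_left 1%R) (locally (Delta2 lambda)) /\
   is_series (Delta2_term lambda) (Delta2 lambda) /\
   is_Cprod (fun n => 1 - lambda ^ 2 / (RtoC (INR n)) ^ 2) (Delta2 lambda)) /\
  ((Cmod lambda < 1)%R ->
   forall (l : C) (u1 : R -> C), Cexp l = lambda -> is_u1 lambda l u1 ->
     exists s : C,
       is_series (fun k => mzv (2 * k + 3 :: nil)%nat * lambda ^ (2 * k + 2)) s /\
       filterlim u1 (at_left 1%R) (locally (2 * Delta2 lambda * (l + s)))).
Proof.
split.
- split; [apply u0_lim_1 | split; [apply is_series_Delta2 | apply euler_prod_lim]].
- intros Hlambda l u1 _ Hu1.
  destruct (is_series_odd_zeta lambda Hlambda) as [s [Hs HK]].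
  exists s. split; [exact Hs|].
  replace (2 * Delta2 lambda * (l + s)) with
    (2 * Delta2 lambda * l + CSeries (weighted_defect lambda 0)) by (rewrite HK; ring).
  apply u1_lim_1; [now apply Delta2_neq_0 | exact Hu1].
Qed.
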